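(* Let $M$ be a gasket automaton satisfying the $\gamma$-isolated condition and with $\mathcal P_{\alpha\gamma}\cup\mathcal P_{\beta\gamma}\neq\emptyset$, and let $M'$ be a one-step simplification of $M$. Then for every $\xi\in(0,1)$ the pseudo-metric spaces $(\mathcal A_M,\tilde\rho_{M,\xi})$ and $(\mathcal A_{M'},\tilde\rho_{M',\xi})$ are Lipschitz equivalent, i.e. there is a bijection $f:\mathcal A_M\to\mathcal A_{M'}$ and $C>0$ with $C^{-1}\tilde\rho_{M,\xi}(a,b)\le\tilde\rho_{M',\xi}(f(a),f(b))\le C\tilde\rho_{M,\xi}(a,b)$ for all $a,b\in\mathcal A_M$.
   Context: $\Sigma=\{1,\dots,N\}$, $\Sigma^\infty$ the infinite words over $\Sigma$. A $\Sigma$-automaton $M$ has finite state set $Q=Q_0\cup\{Id,Exit\}$, input alphabet $\Sigma^2$, initial state $Id$, final state $Exit$, transition $\delta:Q\times\Sigma^2\to Q$ with $\delta(Id,(i,j))=Id$ iff $i=j$. Itinerary of $(\mathbf x,\mathbf y)$: $S_0=Id$, $S_k=\delta(S_{k-1},(x_k,y_k))$, stopped at $Exit$; surviving time $T_M(\mathbf x,\mathbf y)$ = largest $k$ with $S_k\ne Exit$ (possibly $\infty$); $\rho_{M,\xi}(\mathbf x,\mathbf y)=\xi^{T_M(\mathbf x,\mathbf y)}$ ($\xi^\infty=0$). For a gasket automaton, $\rho_{M,\xi}$ is symmetric, vanishes on the diagonal and satisfies $\rho(\mathbf x,\mathbf z)\le C(\rho(\mathbf x,\mathbf y)+\rho(\mathbf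 y,\mathbf z))$; set $\mathbf x\sim\mathbf y$ iff $\rho_{M,\xi}(\mathbf x,\mathbf y)=0$, $\mathcal A_M=\Sigma^\infty/\sim$, and $\tilde\rho_{M,\xi}([\mathbf x],[\mathbf y])=\inf\{\rho_{M,\xi}(\mathbf a,\mathbf b):\mathbf a\in[\mathbf x],\mathbf b\in[\mathbf y]\}$. Triangle automaton: $\alpha,\beta,\gamma$ distinct elements of $\Sigma\cup\{-1,-2,-3\}$; $Q=\{S_{uv}:u\neq v\in\{\alpha,\beta,\gamma\}\}\cup\{Id,Exit\}$; (i) $\delta(Id,(i,j))=S_{uv}\Rightarrow\delta(Id,(j,i))=S_{vu}$; (ii) $\delta(S_{uv},(i,j))=S_{uv}$ if $(i,j)=(v,u)$, else $Exit$. $\mathcal P_{uv}=\{(i,j):\delta(Id,(i,j))=S_{uv}\}$; $i\triangleleft_{uv}j$ iff $(i,j)\in\mathcal P_{uv}$ (equivalently $j\triangleleft_{vu}i$). $j$ is $uv$-minimal if no $i\triangleleft_{uv}j$, $uv$-maximal if no $j\triangleleft_{uv}k$, $uv$-isolated if both. A triangle automaton is thus determined by $\mathcal P_{\alpha\beta},\mathcal P_{\alpha\gamma},\mathcal P_{\beta\gamma}$. Gasket automaton: triangle automaton with (Uniqueness) $i\triangleleft_{uv}j,i\triangleleft_{uv}j'\Rightarrow j=j'$; (Gathering) any two of $a\triangleleft_{\alpha\gamma}c$, $a\triangleleft_{\beta\gamma}b$, $b\triangleleft_{\alpha\beta}c$ imply the third; (Boundary) if $\alpha\in\Sigma$ it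 is $\alpha\gamma$- and $\alpha\beta$-minimal; if $\beta\in\Sigma$ it is $\beta\gamma$- and $\beta\alpha$-minimal; if $\gamma\in\Sigma$ it is $\gamma\alpha$- and $\gamma\beta$-minimal. $\gamma$-isolated condition: $\alpha,\beta,\gamma\in\Sigma$; the directed graph on $\Sigma$ with edge set $\mathcal P_{\alpha\gamma}\cup\mathcal P_{\beta\gamma}$ has no directed cycle; $\gamma$ is $\alpha\gamma$-, $\beta\gamma$- and $\alpha\beta$-isolated. One-step simplification: $b$ is double-maximal if it is $\alpha\gamma$-maximal and $\beta\gamma$-maximal. Choose $(\tau,\kappa)\in\mathcal P_{\alpha\gamma}\cup\mathcal P_{\beta\gamma}$ with $\kappa$ double-maximal. If $(\tau,\kappa)\in\mathcal P_{\alpha\gamma}$: when $\kappa$ has no $\alpha\beta$-predecessor set $\mathcal P'_{\alpha\beta}=\mathcal P_{\alpha\beta}$, $\mathcal P'_{\alpha\gamma}=\mathcal P_{\alpha\gamma}\setminus\{(\tau,\kappa)\}$, $\mathcal P'_{\beta\gamma}=\mathcal P_{\beta\gamma}$; when $\kappa$ has an $\alpha\beta$-predecessor $\lambda$ (i.e. $\lambda\triangleleft_{\alpha\beta}\kappa$) set $\mathcal P'_{\alpha\beta}=\mathcal P_{\alpha\beta}$, $\mathcal P'_{\alpha\gamma}=\mathcal P_{\alpha\gamma}\setminus\{(\tau,\kappa)\}$, $\mathcal P'_{\beta\gamma}=\mathcal P_{\beta\gamma}\setminus\{(\tau,\lambda)\}$. If $(\tau,\kappa)\in\mathcal P_{\beta\gamma}$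 the definition is the same with the roles of $\alpha$ and $\beta$ interchanged. $M'$ is the triangle automaton determined by $\mathcal P'_{\alpha\beta},\mathcal P'_{\alpha\gamma},\mathcal P'_{\beta\gamma}$. *)

(* Defs.v *)
From mathcomp Require Import all_boot all_order all_algebra.
From mathcomp Require Import boolp classical_sets reals.
Set Implicit Arguments. Unset Strict Implicit. Unset Printing Implicit Defensive.
Import Order.TTheory GRing.Theory Num.Theory.
Local Open Scope ring_scope.

(* Alphabet Sigma = {1,...,N} is modelled by 'I_N (letter k+1 <-> ordinal k).
   Vertex labels alpha, beta, gamma live in Sigma ∪ {-1,-2,-3}, modelled by
   'I_N + 'I_3  (inl k = letter, inr k = -(k+1)). *)
Definition label (N : nat) := ('I_N + 'I_3)%type.

(* Infinite words x = x_1 x_2 ...; x_k is [x (k-1)]. *)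
Definition word (N : nat) := nat -> 'I_N.

(* Triangle automaton data.  The three vertices are indexed by 'I_3:
   0 = alpha, 1 = beta, 2 = gamma; [lab] gives their labels.
   The automaton is determined by P_ab, P_ag, P_bg. *)
Record tri_data (N : nat) := TriData {
  lab : 'I_3 -> label N;
  Pab : rel 'I_N;
  Pag : rel 'I_N;
  Pbg : rel 'I_N
}.

Definition vA : 'I_3 := @Ordinal 3 0 isT.
Definition vB : 'I_3 := @Ordinal 3 1 isT.
Definition vC : 'I_3 := @Ordinal 3 2 isT.

Definition P (N : nat) (M : tri_data N) (u v : 'I_3) : rel 'I_N :=
  fun i j =>
  match nat_of_ord u, nat_of_ord v with
  | 0, 1 => Pab M i j | 1, 0 => Pab M j i
  | 0, 2 => Pag M i j | 2, 0 => Pag M j i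
  | 1, 2 => Pbg M i j | 2, 1 => Pbg M j i
  | _, _ => false
  end.

(* Well-formedness of a triangle automaton: distinct labels, and the
   transition from Id is a well-defined function with delta(Id,(i,j)) = Id
   iff i = j (so no (i,i) in any P_uv and the P_uv are pairwise disjoint). *)
Definition triangle_wf (N : nat) (M : tri_data N) : Prop :=
  injective (lab M) /\
  (forall u v i, ~~ P M u v i i) /\
  (forall u v u' v' i j, u != v -> u' != v' -> P M u v i j -> P M u' v' i j ->
      u = u' /\ v = v').

Definition state := option (option ('I_3 * 'I_3)).
Definition Exit : state := None.
Definition IdSt : state := Some None.
Definition St (u v : 'I_3) : state := Some (Some (u, v)).

Definition delta (N : nat) (M : tri_data N) (s : state) (i j : 'I_N) : state :=
  match s with
  | None => Exit
  | Some None =>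
      if i == j then IdSt else
      if [pick uv : 'I_3 * 'I_3 | (uv.1 != uv.2) && P M uv.1 uv.2 i j] is Some uv
      then St uv.1 uv.2 else Exit
  | Some (Some (u, v)) =>
      if (lab M v == inl i) && (lab M u == inl j) then St u v else Exit
  end.

Fixpoint itin (N : nat) (M : tri_data N) (x y : word N) (k : nat) : state :=
  match k with
  | 0 => IdSt
  | k'.+1 => delta M (itin M x y k') (x k') (y k')
  end.

Definition exits (N : nat) (M : tri_data N) (x y : word N) : pred nat :=
  fun k => itin M x y k == Exit.

(* rho_{M,xi}(x,y) = xi^{T_M(x,y)}, T = largest k with S_k <> Exit
   = (first k with S_k = Exit) - 1; T = oo (rho = 0) if Exit is never reached. *)
Definition rho (R : realType) (N : nat) (M : tri_data N) (xi : R)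
    (x y : word N) : R :=
  match pselect (exists k, exits M x y k) with
  | left H => xi ^+ (ex_minn H).-1
  | right _ => 0
  end.

Definition cls (R : realType) (N : nat) (M : tri_data N) (xi : R) (x : word N)
  : word N -> Prop := fun y => rho M xi x y = 0.

Definition AM (R : realType) (N : nat) (M : tri_data N) (xi : R) :=
  { A : word N -> Prop | exists x, A = cls M xi x }.

Definition rho_t (R : realType) (N : nat) (M : tri_data N) (xi : R)
    (A B : AM M xi) : R :=
  inf [set r : R | exists a b, proj1_sig A a /\ proj1_sig B b /\ r = rho M xi a b].

Definition is_min (N : nat) (M : tri_data N) (u v : 'I_3) (j : 'I_N) :=
  forall i, ~~ P M u v i j.
Definition is_max (N : nat) (M : tri_data N) (u v : 'I_3) (j : 'I_N) :=
  forall k, ~~ P M u v j k.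

Definition gasket (N : nat) (M : tri_data N) : Prop :=
  triangle_wf M /\
  (forall u v i j j', u != v -> P M u v i j -> P M u v i j' -> j = j') /\
  (forall a b c,
     (Pag M a c -> Pbg M a b -> Pab M b c) /\
     (Pag M a c -> Pab M b c -> Pbg M a b) /\
     (Pbg M a b -> Pab M b c -> Pag M a c)) /\
  (forall a, lab M vA = inl a -> is_min M vA vC a /\ is_min M vA vB a) /\
  (forall b, lab M vB = inl b -> is_min M vB vC b /\ is_min M vB vA b) /\
  (forall c, lab M vC = inl c -> is_min M vC vA c /\ is_min M vC vB c).

Definition gamma_isolated (N : nat) (M : tri_data N) : Prop :=
  exists a b c : 'I_N,
    [/\ lab M vA = inl a, lab M vB = inl b, lab M vC = inl c,
     (forall (i : 'I_N) (s : seq 'I_N),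
        s != [::] -> path (fun p q => Pag M p q || Pbg M p q) i s ->
        last i s != i) &
     [/\ is_min M vA vC c /\ is_max M vA vC c, is_min M vB vC c /\
         is_max M vB vC c & is_min M vA vB c /\ is_max M vA vB c]].

Definition double_max (N : nat) (M : tri_data N) (b : 'I_N) :=
  is_max M vA vC b /\ is_max M vB vC b.

Definition rm (N : nat) (R : rel 'I_N) (p q : 'I_N) : rel 'I_N :=
  fun i j => R i j && ((i, j) != (p, q)).

Definition one_step_simplification (N : nat) (M M' : tri_data N) : Prop :=
  lab M' = lab M /\
  exists tau kappa : 'I_N, double_max M kappa /\
   ((Pag M tau kappa /\
     (((forall l, ~~ Pab M l kappa) /\
        Pab M' =2 Pab M /\ Pag M' =2 rm (Pag M) tau kappa /\ Pbg M' =2 Pbg M)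
      \/
      (exists l, Pab M l kappa /\
        Pab M' =2 Pab M /\ Pag M' =2 rm (Pag M) tau kappa /\
        Pbg M' =2 rm (Pbg M) tau l)))
    \/
    (Pbg M tau kappa /\
     (((forall l, ~~ P M vB vA l kappa) /\
        Pab M' =2 Pab M /\ Pbg M' =2 rm (Pbg M) tau kappa /\ Pag M' =2 Pag M)
      \/
      (exists l, P M vB vA l kappa /\
        Pab M' =2 Pab M /\ Pbg M' =2 rm (Pbg M) tau kappa /\
        Pag M' =2 rm (Pag M) tau l)))).

Definition lipschitz_equiv (R : realType) (N : nat) (M M' : tri_data N) (xi : R)
  : Prop :=
  exists f : AM M xi -> AM M' xi, bijective f /\
  exists C : R, 0 < C /\
    forall a b, C^-1 * rho_t a b <= rho_t (f a) (f b) /\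
                rho_t (f a) (f b) <= C * rho_t a b.

(* Main.v *)
(** Write w i p for a corner of a cell, i.e. for the point w i p p p ... where p
    is one of the three vertex letters; then T_M(x, y) measures how long x and y
    stay in the same cell or in two cells with a common corner.  Passing from M
    to M' detaches every corner w tau gamma from the corner w kappa alpha (and
    from w lambda beta, if lambda exists) and changes nothing else, so a
    bi-Lipschitz bijection has to create one new point for every w.

    Since gamma is isolated, w tau gamma^oo is the limit of the annuli
    w tau gamma^n i (i <> gamma), and each annulus is separated from the rest at
    its own scale.  Near the point w kappa alpha^oo there are further such
    sequences of annuli, those of w kappa alpha^m kappa gamma^n i, and since
    kappa is double-maximal their limits touch nothing.  As in Hilbert's hotel,
    shift the sequence of w kappa alpha^(m+1) kappa, with its limit, to that of
    w kappa alpha^m kappa, and the sequence of w kappa kappa to that of w tau;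
    this leaves one vacant annulus in each sequence w kappa alpha^m kappa, into
    which the annuli of w tau are distributed.  The annuli of w tau already
    accumulate at w kappa alpha^oo in M, so everything moves by a distance
    comparable to its size.  Cutting words after each maximal run of gamma and
    recoding every block in this way preserves lengths and changes surviving
    times by at most 6.  When (tau, kappa) lies in P_(beta gamma), the same
    argument applies with beta in place of alpha. *)

Require Import Defs.
From mathcomp Require Import all_boot all_order all_algebra.
From mathcomp Require Import boolp classical_sets reals.
From mathcomp Require Import zify.
Set Implicit Arguments. Unset Strict Implicit. Unset Printing Implicit Defensive.
Import Order.TTheory GRing.Theory Num.Theory.

Local Open Scope nat_scope.

(** * Words, blocks and surviving times *)

Section Words.
Variable L : eqType.
Implicit Types (x y z : nat -> L) (s t u U V : seq L).

Definition catw s x : nat -> L :=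
  fun n => if n < size s then nth (x 0) s n else x (n - size s).

Definition starts s x := mkseq x (size s) = s.

Lemma starts_nth s x d i : starts s x -> i < size s -> nth d s i = x i.
Proof. by move=> <-; rewrite size_mkseq => ?; rewrite nth_mkseq. Qed.

Lemma starts_catw s x : starts s (catw s x).
Proof.
apply: (@eq_from_nth _ (x 0)) => [|i]; rewrite size_mkseq // => lt_i.
by rewrite nth_mkseq // /catw lt_i.
Qed.

Lemma catw_ge s x n : catw s x (size s + n) = x n.
Proof. by rewrite /catw ltnNge leq_addr addKn. Qed.

Lemma take_mkseq x n m : n <= m -> take n (mkseq x m) = mkseq x n.
Proof. by move=> le_nm; rewrite /mkseq -map_take take_iota (minn_idPl le_nm). Qed.

Lemma starts_take s x n : starts s x -> starts (take n s) x.
Proof.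
rewrite /starts => Hs; rewrite size_take_min; case: (leqP n (size s)) => le_ns.
  by rewrite -[in RHS]Hs take_mkseq.
by rewrite take_oversize // ltnW.
Qed.

Lemma starts_catl s t x : starts (s ++ t) x -> starts s x.
Proof. by move/(@starts_take _ _ (size s)); rewrite take_size_cat. Qed.

Lemma starts_prefix s t x :
  starts s x -> starts t x -> size s <= size t -> s = take (size s) t.
Proof. by move=> Hs Ht le_st; rewrite -[in RHS]Ht take_mkseq // Hs. Qed.

Lemma eq_starts s x y :
  (forall i, i < size s -> x i = y i) -> starts s x -> starts s y.
Proof.
move=> eq_xy Hs; rewrite /starts -[RHS]Hs.
by apply/eq_in_map => i; rewrite mem_iota => /andP[_ lt_i]; rewrite eq_xy.
Qed.

Lemma starts_eq s x y i : starts s x -> starts s y -> i < size s -> x i = y i.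
Proof. by move=> Hx Hy lt_i; rewrite -(starts_nth (x 0) Hx) // -(starts_nth (x 0) Hy). Qed.

Lemma startsP s x :
  (forall i, i < size s -> nth (x 0) s i = x i) -> starts s x.
Proof.
move=> H; apply: (@eq_from_nth _ (x 0)) => [|i]; rewrite size_mkseq // => lt_i.
by rewrite nth_mkseq // H.
Qed.

Lemma starts_cat_nseq s n p x : starts s x ->
  (forall i, size s <= i < size s + n -> x i = p) -> starts (s ++ nseq n p) x.
Proof.
move=> Hs Hp; apply: startsP => i; rewrite size_cat size_nseq nth_cat => lt_i.
case: ltnP => le_i; first exact: starts_nth.
by rewrite nth_nseq ifT ?Hp ?le_i //; lia.
Qed.

Lemma starts_rcons s x : starts s x -> starts (s ++ [:: x (size s)]) x.
Proof.
move=> Hs; apply: (@starts_cat_nseq s 1) => // i Hi.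
by congr x; lia.
Qed.

Variable g : L.

(* [U g^n] is the part of [x] up to the end of its first maximal run of [g], or
   agrees with that part up to length [m]. *)
Definition chunk m x U n :=
  [/\ g \notin U, starts (take m (U ++ nseq n g)) x &
      m <= size U + n \/ (0 < n /\ x (size U + n) <> g)].

Lemma chunk_U m x U n i : chunk m x U n -> i < size U -> i < m -> x i <> g.
Proof.
case=> gU sx _ iU im eg; move: gU; suff -> : g \in U by [].
have := starts_nth g sx (i := i); rewrite size_take_min size_cat size_nseq.
move=> /(_ ltac:(lia)); rewrite nth_take // nth_cat iU eg => <-.
exact: mem_nth.
Qed.

Lemma chunk_G m x U n i :
  chunk m x U n -> size U <= i < size U + n -> i < m -> x i = g.
Proof.
case=> gU sx _ iU im.
have := starts_nth g sx (i := i); rewrite size_take_min size_cat size_nseq.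
move=> /(_ ltac:(lia)); rewrite nth_take // nth_cat ltnNge.
by case/andP: iU => -> _ /=; rewrite nth_nseq if_same => <-.
Qed.

(** A prefix without [g] cannot pass the end of [U]: within the first [m] letters [U] is followed by
    [g], because [n = 0] is allowed only when [U] already covers [m]. *)
Lemma chunk_free m x U n u :
  chunk m x U n -> g \notin u -> starts u x -> size u <= m ->
  size u <= size U /\ u = take (size u) U.
Proof.
move=> cx gu su um.
have ng i : i < size u -> x i <> g.
  by move=> iu; rewrite -(starts_nth g su iu) => e; move: gu; rewrite -e mem_nth.
have le_uU : size u <= size U.
  rewrite leqNgt; apply/negP => lt_Uu.
  have n0 : 0 < n by case: cx => _ _ [|[]//]; lia.
  by apply: (ng _ lt_Uu); apply: (chunk_G cx); lia.
split=> //; case: cx => _ sx _.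
rewrite {1}(starts_prefix su sx); last by rewrite size_take_min size_cat size_nseq; lia.
by rewrite take_takel // take_cat; case: ltngtP le_uU => // ->; rewrite subnn take0 cats0 take_size.
Qed.

(** One [g] after [u] already fixes where [U] ends; the run in [x] may go on, hence only
    [r <= n]. *)
Lemma chunk_pure m x U n u r :
  chunk m x U n -> g \notin u -> 0 < r -> starts (u ++ nseq r g) x ->
  size u + r <= m -> u = U /\ r <= n.
Proof.
move=> cx gu r0 sux um.
have [le_uU eu] := chunk_free cx gu (starts_catl sux) ltac:(lia).
have xg i : size u <= i < size u + r -> x i = g.
  move=> iu; rewrite -(starts_nth g sux) ?size_cat ?size_nseq; last by lia.
  by rewrite nth_cat ltnNge; case/andP: iu => -> _ /=; rewrite nth_nseq if_same.
have eqs : size u = size U.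
  apply/eqP; rewrite eqn_leq le_uU leqNgt; apply/negP => lt_uU.
  by apply: (chunk_U cx lt_uU); [lia|apply: xg; lia].
split; first by rewrite eu eqs take_size.
rewrite leqNgt; apply/negP => lt_nr; case: (cx) => _ _ [|[_]]; first by lia.
by apply; apply: xg; lia.
Qed.

(** A chunk that reaches [m] is not unique, since what lies beyond [m] is free; one that ends before
    [m] is determined by [x]. *)
Lemma chunk_uniq m x U n V l :
  chunk m x U n -> chunk m x V l -> size U + n < m -> U = V /\ n = l.
Proof.
move=> cU cV lt_m.
have [n0 xU] : 0 < n /\ x (size U + n) <> g by case: cU => _ _ []; [lia|].
have sU : starts (U ++ nseq n g) x.
  case: cU => _ + _; rewrite take_oversize // size_cat size_nseq; lia.
have [gU gV] : g \notin U /\ g \notin V by case: cU => ? _ _; case: cV.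
have [eUV le_nl] := chunk_pure cV gU n0 sU ltac:(lia).
split=> //; subst V; apply/eqP; rewrite eqn_leq le_nl leqNgt; apply/negP => lt_nl.
by apply: xU; apply: (chunk_G cV); lia.
Qed.

Variable E : L -> L -> L -> L -> Prop.
Hypothesis E_neq : forall i p j q, E i p j q -> i <> j.

(* [E i p j q] means that corner [p] of [i] is corner [q] of [j]; [surv x y n]
   then says that the surviving time of [x, y] is at least [n]. *)
Definition surv x y n :=
  (forall i, i < n -> x i = y i) \/
  exists d p q, [/\ d < n, forall i, i < d -> x i = y i, E (x d) p (y d) q &
    forall i, d < i < n -> x i = p /\ y i = q].

Lemma survW x y n m : m <= n -> surv x y n -> surv x y m.
Proof.
move=> le_mn [H|[d [p [q [dn H Hd Hr]]]]]; first by left=> i im; apply: H; lia.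
case: (leqP m d) => dm; first by left=> i im; apply: H; lia.
by right; exists d, p, q; split=> // i im; apply: Hr; lia.
Qed.

Lemma surv_agree s x y : starts s x -> starts s y -> surv x y (size s).
Proof. by move=> sx sy; left=> i; apply: starts_eq. Qed.

Lemma surv_corner u i p j q r x y :
  E i p j q -> starts (u ++ i :: nseq r p) x -> starts (u ++ j :: nseq r q) y ->
  surv x y (size u + r.+1).
Proof.
move=> Eij sx sy; right; exists (size u), p, q.
have xi k : size u < k < size u + r.+1 -> x k = p.
  move=> Hk; rewrite -(starts_nth p sx) ?size_cat /= ?size_nseq; last by lia.
  rewrite nth_cat ltnNge ifF; last by lia.
  by rewrite -[k - _]prednK ?subn_gt0 //=; [rewrite nth_nseq if_same|lia].
have yi k : size u < k < size u + r.+1 -> y k = q.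
  move=> Hk; rewrite -(starts_nth q sy) ?size_cat /= ?size_nseq; last by lia.
  rewrite nth_cat ltnNge ifF; last by lia.
  by rewrite -[k - _]prednK ?subn_gt0 //=; [rewrite nth_nseq if_same|lia].
split; first by lia.
- by move=> k; apply: starts_eq (starts_catl sx) (starts_catl sy).
- rewrite -(starts_nth p sx) ?size_cat /= ?size_nseq; last by lia.
  rewrite -(starts_nth p sy) ?size_cat /= ?size_nseq; last by lia.
  by rewrite !nth_cat ltnn subnn.
- by move=> k Hk; split; [apply: xi|apply: yi].
Qed.

(** Inside [s] the words coincide, so by [E_neq] they cannot part there. Truncated subtraction
    covers [n <= size s]. *)
Lemma surv_catw s x y n : surv (catw s x) (catw s y) n <-> surv x y (n - size s).
Proof.
have lo i : i < size s -> catw s x i = catw s y i.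
  by move=> Hi; rewrite /catw Hi; apply: set_nth_default.
have hi z i : size s <= i -> catw s z i = z (i - size s).
  by rewrite /catw leqNgt => /negbTE ->.
split=> [[H|[d [p [q [dn H Hd Hr]]]]]|[H|[d [p [q [dn H Hd Hr]]]]]].
- by left=> i im; rewrite -[i](addKn (size s)) -!hi; [apply: H; lia|lia|lia].
- case: (ltnP d (size s)) => ds.
    by case: (E_neq Hd); apply: lo.
  right; exists (d - size s), p, q; rewrite !hi // in Hd; split=> //; first lia.
    by move=> i im; rewrite -[i](addKn (size s)) -!hi; [apply: H; lia|lia|lia].
  move=> i im; rewrite -[i](addKn (size s)) -!hi; [apply: Hr; lia|lia|lia].
- left=> i im; case: (ltnP i (size s)) => is_; first exact: lo.
  by rewrite !hi //; apply: H; lia.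
- right; exists (size s + d), p, q; rewrite !hi ?addKn ?leq_addr //; split=> //.
  + lia.
  + move=> i im; case: (ltnP i (size s)) => is_; first exact: lo.
    by rewrite !hi //; apply: H; lia.
  + by move=> i im; rewrite !hi; [apply: Hr; lia|lia|lia].
Qed.

End Words.

(** * Where two surviving words part *)

Section Split.
Variables (L : eqType) (g : L) (E : L -> L -> L -> L -> Prop).
Hypothesis E_g : forall i p j q, E i p j q -> i <> g /\ j <> g.
Implicit Types (x y z : nat -> L) (s t u U V : seq L).

Lemma chunk_short m x y U n V l :
  chunk g m x U n -> chunk g m y V l -> size U + n < m ->
  (forall i, i < size U + n -> x i = y i) -> y (size U + n) <> g ->
  U = V /\ n = l.
Proof.
move=> cx cy lt_m eq_xy yg; apply: (chunk_uniq (x := y) _ cy lt_m).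
case: cx => gU sx [|[n0 _]]; first by lia.
split=> //; last by right.
apply: eq_starts sx => i; rewrite size_take_min size_cat size_nseq => Hi.
by apply: eq_xy; lia.
Qed.

(** Agreement past a completed run of [g] would make the chunks equal, which [same] allows only if
    they reach [m]. By [E_g] the letters at which the words part are not [g], so the words part
    inside [U], and the common prefix [u] is free of [g]. *)
Lemma surv_split m x y U n V l :
  chunk g m x U n -> chunk g m y V l ->
  (U = V -> n = l -> m <= size U + n) -> surv E x y m ->
  (exists u r, [/\ g \notin u, size u + r = m, starts (u ++ nseq r g) x &
     starts (u ++ nseq r g) y]) \/
  (exists u i p j q r, [/\ g \notin u, E i p j q, size u + r.+1 = m,
     starts (u ++ i :: nseq r p) x & starts (u ++ j :: nseq r q) y]).
Proof.
move=> cx cy same [eq_xy|[d [p [q [dm eq_xy Exy Hr]]]]].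
  left; have le_m : m <= size U + n.
    rewrite leqNgt; apply/negP => lt_m.
    have yg : y (size U + n) <> g.
      rewrite -eq_xy //; case: (cx) => _ _ [|[]//]; lia.
    have [eU en] := chunk_short cx cy lt_m (fun i Hi => eq_xy i (ltn_trans Hi lt_m)) yg.
    by have := same eU en; lia.
  have sx : starts (take m (U ++ nseq n g)) x by case: cx.
  exists (take m U), (m - size (take m U)).
  have e : take m U ++ nseq (m - size (take m U)) g = take m (U ++ nseq n g).
    rewrite take_cat; case: ltnP => HU.
      by rewrite size_takel ?subnn ?cats0 // ltnW.
    by rewrite take_oversize // take_nseq //; lia.
  rewrite e; split=> //.
  - by case: cx => gU _ _; apply: contra gU; apply: mem_take.
  - by rewrite subnKC // size_take_min geq_minl.
  - apply: eq_starts sx => i; rewrite size_take_min => Hi; apply: eq_xy; lia.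
right; have [xg yg] := E_g Exy.
have dU : d < size U.
  rewrite ltnNge; apply/negP => Ud; case: (ltnP d (size U + n)) => dn.
    by apply: xg; apply: (chunk_G cx); rewrite ?Ud.
  have lt_m : size U + n < m by lia.
  have yg' : y (size U + n) <> g.
    case: (ltngtP d (size U + n)) dn => // [lt_d _|<- //].
    rewrite -eq_xy //; case: (cx) => _ _ [|[]//]; lia.
  have [eU en] := chunk_short cx cy lt_m (fun i Hi => eq_xy i (leq_trans Hi dn)) yg'.
  by have := same eU en; lia.
have sx : starts (take d U) x.
  case: (cx) => _ /(@starts_take _ _ _ d) + _.
  by rewrite take_takel ?(ltnW dm) // take_cat dU.
have sd : size (take d U) = d by rewrite size_takel // ltnW.
have sy : starts (take d U) y by apply: eq_starts sx => i; rewrite sd; apply: eq_xy.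
exists (take d U), (x d), p, (y d), q, (m - d.+1); split=> //.
- by case: cx => gU _ _; apply: contra gU; apply: mem_take.
- by rewrite sd; lia.
- rewrite -cat1s catA; apply: starts_cat_nseq; first by rewrite -{2}sd; apply: starts_rcons.
  by move=> i; rewrite size_cat sd /= => Hi; apply: (Hr i _).1; lia.
- rewrite -cat1s catA; apply: starts_cat_nseq; first by rewrite -{2}sd; apply: starts_rcons.
  by move=> i; rewrite size_cat sd /= => Hi; apply: (Hr i _).2; lia.
Qed.

End Split.

(** * The recoding of a block *)

Lemma nseq_cat_inj (L : eqType) (a i i' : L) m m' r r' : i <> a -> i' <> a ->
  nseq m a ++ i :: r = nseq m' a ++ i' :: r' -> [/\ m = m', i = i' & r = r'].
Proof.
move=> ia ia'; elim: m m' => [|m IH] [|m'] //= [].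
- by move=> -> ->.
- by move/ia.
- by move/esym/ia'.
- by move/IH => [-> -> ->].
Qed.

Lemma rev_cat_nseq (L : eqType) (a i : L) m s :
  rev (s ++ i :: nseq m a) = nseq m a ++ i :: rev s.
Proof. by rewrite rev_cat rev_cons rev_nseq cat_rcons. Qed.

Section Blocks.
Variables (L : eqType) (g a t k : L).
Hypotheses (ka : k <> a) (tk : t <> k).
Implicit Types (x y z : nat -> L) (s u w U V : seq L).

(* With [C 0 s = s t] and [C (m+1) s = s k a^m k], the recoding permutes
   cyclically the blocks [C e s g^n] with [e + n >= 2] constant and [n > 0]. *)
Definition C e s := s ++ (if e is m.+1 then k :: nseq m a ++ [:: k] else [:: t]).

(** Read from the right: the last letter tells [e = 0] from [e > 0], and since [k <> a] the run of
    [a] before the final [k] has a definite length. *)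
Lemma C_inj e e' s s' : C e s = C e' s' -> e = e' /\ s = s'.
Proof.
move=> /(congr1 rev); rewrite /C !rev_cat.
case: e e' => [|m] [|m']; rewrite ?rev_cons ?rev_cat /= -?cats1 ?rev_nseq -?catA /=.
- by case=> /(inv_inj revK) ->.
- by case=> /tk.
- by case=> /esym/tk.
- by case=> /(nseq_cat_inj ka ka) [-> _ /(inv_inj revK) ->].
Qed.

Lemma C_last e s u i : u ++ [:: i] = C e s -> i = t \/ i = k.
Proof.
move=> /(congr1 (last i)); rewrite /C !last_cat /=.
by case: e => [|m] /= ->; [left|right; rewrite last_cat].
Qed.

(** [blk_wrap] closes the cycle along which [blk_shift] moves; [blk_short] is the remaining case
    [e + n = 1], a cycle of length one. *)
Inductive blk : seq L -> nat -> seq L -> nat -> Prop :=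
| blk_shift e s n : blk (C e.+1 s) n.+1 (C e s) n.+2
| blk_wrap s m : blk (C 0 s) m.+2 (C m.+1 s) 1
| blk_short s : blk (C 0 s) 1 (C 0 s) 1
| blk_id U n : n = 0 \/ (forall e s, U <> C e s) -> blk U n U n.

Lemma blk0 U U' n n' : blk U n U' n' -> n = 0 \/ n' = 0 -> U = U' /\ n = n'.
Proof. by case=> // [e s {}n|s m] []. Qed.

Lemma blk_nsp U n U' n' : blk U n U' n' -> 
  (forall e s, U <> C e s) \/ (forall e s, U' <> C e s) -> U = U' /\ n = n'.
Proof.
by case=> // [e s {}n|s m] [] H; [case: (H e.+1 s)|case: (H e s)|
  case: (H 0 s)|case: (H m.+1 s)].
Qed.

Lemma blk_Cl e s n U' n' : blk (C e s) n.+1 U' n' ->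
  match e, n with
  | 0, 0 => U' = C 0 s /\ n' = 1
  | 0, m.+1 => U' = C m.+1 s /\ n' = 1
  | e.+1, _ => U' = C e s /\ n' = n.+2
  end.
Proof.
move EU: (C e s) => U; move EN: n.+1 => N H.
case: H EU EN => [e1 s1 n1|s1 m1|s1|U1 n1 H] eU.
- by case/C_inj: eU => -> -> [?]; subst.
- by case/C_inj: eU => -> -> [?]; subst.
- by case/C_inj: eU => -> -> [?]; subst.
- by case: H => [-> //|H]; case: (H e s).
Qed.

Lemma blk_Cr e s n U n' : blk U n' (C e s) n.+1 ->
  match e, n with
  | 0, 0 => U = C 0 s /\ n' = 1
  | m.+1, 0 => U = C 0 s /\ n' = m.+2
  | e, n.+1 => U = C e.+1 s /\ n' = n.+1
  end.
Proof.
move EU: (C e s) => U'; move EN: n.+1 => N H.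
case: H EU EN => [e1 s1 n1|s1 m1|s1|U1 n1 H] eU.
- by case/C_inj: eU => -> -> [?]; subst; case: e1.
- by case/C_inj: eU => -> -> [?]; subst.
- by case/C_inj: eU => -> -> [?]; subst.
- by case: H => [-> //|H]; case: (H e s).
Qed.

Lemma special_or_not U : (exists e s, U = C e s) \/ (forall e s, U <> C e s).
Proof.
case: (pselect (exists e s, U = C e s)) => [|H]; [by left|right=> e s eU].
by apply: H; exists e, s.
Qed.

Lemma blk_fun U n U1 n1 U2 n2 :
  blk U n U1 n1 -> blk U n U2 n2 -> U1 = U2 /\ n1 = n2.
Proof.
case: n => [|n] H1 H2.
  by have [? ?] := blk0 H1 (or_introl erefl); have [? ?] := blk0 H2 (or_introl erefl); subst.
have [[e [s eU]]|H] := special_or_not U; last first.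
  by have [? ?] := blk_nsp H1 (or_introl H); have [? ?] := blk_nsp H2 (or_introl H); subst.
subst U; have := (blk_Cl H1, blk_Cl H2).
by case: e n {H1 H2} => [|e] [|n] [[-> ->] [-> ->]].
Qed.

Lemma blk_inj U n U1 n1 U2 n2 :
  blk U1 n1 U n -> blk U2 n2 U n -> U1 = U2 /\ n1 = n2.
Proof.
case: n => [|n] H1 H2.
  by have [? ?] := blk0 H1 (or_intror erefl); have [? ?] := blk0 H2 (or_intror erefl); subst.
have [[e [s eU]]|H] := special_or_not U; last first.
  by have [? ?] := blk_nsp H1 (or_intror H); have [? ?] := blk_nsp H2 (or_intror H); subst.
subst U; have := (blk_Cr H1, blk_Cr H2).
by case: e n {H1 H2} => [|e] [|n] [[-> ->] [-> ->]].
Qed.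

Lemma size_C e s : size (C e s) = size s + e.+1.
Proof. by rewrite /C size_cat; case: e => [|m] //=; rewrite size_cat size_nseq /=; lia. Qed.

Lemma blk_size U n U' n' : blk U n U' n' -> size U + n = size U' + n'.
Proof. by case=> // *; rewrite !size_C; lia. Qed.

Lemma C_split m s : C m.+2 s = (s ++ k :: nseq m a) ++ [:: a; k].
Proof. by rewrite /C -[m.+1]addn1 nseqD -!catA. Qed.

Lemma CS m s : C m.+1 s = (s ++ k :: nseq m a) ++ [:: k].
Proof. by rewrite /C -!catA. Qed.

(** A shift changes the final [k k] into [t], or [a k] into [k], and a wrap changes only the final
    [t]; so at most two letters of [U] are lost. *)
Lemma blk_prefixl U n U' n' : blk U n U' n' ->
  exists w r r', [/\ U = w ++ r, U' ++ nseq n' g = w ++ r' & size r <= 2].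
Proof.
case=> [[|m] s {}n|s m|s|{}U {}n _].
- by exists s, [:: k; k], ([:: t] ++ nseq n.+2 g); rewrite /C -!catA.
- exists (s ++ k :: nseq m a), [:: a; k], (k :: nseq n.+2 g).
  by rewrite C_split CS -(catA _ [:: k]).
- by exists s, [:: t], (k :: nseq m a ++ k :: nseq 1 g); rewrite CS -!catA.
- by exists (C 0 s), [::], (nseq 1 g); rewrite cats0.
- by exists U, [::], (nseq n g); rewrite cats0.
Qed.

(** Undoing a wrap turns [k a^m k] into [t], an unbounded loss of common prefix; it stays a case of
    its own, to be treated by [near]. *)
Lemma blk_prefixr U n U' n' : blk U n U' n' ->
  (exists w r r', [/\ U' = w ++ r, U ++ nseq n g = w ++ r' & size r <= 2]) \/
  exists s m, [/\ U = C 0 s, n = m.+2 & U' = C m.+1 s].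
Proof.
case=> [[|m] s {}n|s m|s|{}U {}n _].
- by left; exists s, [:: t], ([:: k; k] ++ nseq n.+1 g); rewrite /C -!catA.
- left; exists (s ++ k :: nseq m a), [:: k], ([:: a; k] ++ nseq n.+1 g).
  by rewrite C_split CS -(catA _ [:: a; k]).
- by right; exists s, m.
- by left; exists (C 0 s), [::], (nseq 1 g); rewrite cats0.
- by left; exists U, [::], (nseq n g); rewrite cats0.
Qed.

Lemma chunk_cat m x U n w r :
  chunk g m x U n -> U ++ nseq n g = w ++ r -> size w <= m -> starts w x.
Proof.
case=> _ sx _ e wm; move: (starts_take (size w) sx).
by rewrite e take_takel // take_size_cat.
Qed.

Definition chunks m x U n x' U' n' :=
  [/\ chunk g m x U n, chunk g m x' U' n' & blk U n U' n'].

Lemma chunks_freel m x U n x' U' n' u :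
  chunks m x U n x' U' n' -> g \notin u -> starts u x -> size u <= m ->
  starts (take (size u - 2) u) x'.
Proof.
case=> cx cx' b gu su um; have [le_u eu] := chunk_free cx gu su um.
have [w [r [r' [eU eU' r2]]]] := blk_prefixl b.
have sw : size u - 2 <= size w.
  by move: le_u; rewrite eU size_cat; lia.
have -> : take (size u - 2) u = take (size u - 2) w.
  by rewrite eu size_takel // take_takel ?leq_subr // eU takel_cat.
apply: (chunk_cat (r := drop (size u - 2) w ++ r') cx').
  by rewrite catA cat_take_drop.
by rewrite size_takel //; lia.
Qed.

(* Before the corner [t g] is detached, the cell [s t g^e] touches [s k a^e]. *)
Definition near w x := starts w x \/
  exists s e, w = s ++ k :: nseq e a /\ starts (s ++ t :: nseq e g) x.

Lemma chunks_freer m x U n x' U' n' u :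
  chunks m x U n x' U' n' -> g \notin u -> starts u x' -> size u <= m ->
  near (take (size u - 2) u) x.
Proof.
case=> cx cx' b gu su um; have [le_u eu] := chunk_free cx' gu su um.
have e2 : take (size u - 2) u = take (size u - 2) U'.
  by rewrite {2}eu take_takel // leq_subr.
have [[w [r [r' [eU' eU r2]]]]|[s [e [eU en eU']]]] := blk_prefixr b.
  left; have sw : size u - 2 <= size w.
    by move: le_u; rewrite eU' size_cat; lia.
  rewrite e2 eU' takel_cat //.
  apply: (chunk_cat (r := drop (size u - 2) w ++ r') cx).
    by rewrite catA cat_take_drop.
  by rewrite size_takel //; lia.
rewrite e2; move: cx le_u; rewrite eU en eU' => cx; rewrite size_C => le_u.
case: (leqP (size u - 2) (size s)) => us.
  left; rewrite /C takel_cat //.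
  apply: (chunk_cat (r := drop (size u - 2) s ++ [:: t] ++ nseq e.+2 g) cx).
    by rewrite catA cat_take_drop /C -catA.
  by rewrite size_takel //; lia.
(* The [c] letters [a] left after [s k] are matched by [c] letters [g] after [s t] in the
   preimage. *)
right; pose c := size u - 2 - (size s).+1; exists s, c; split.
  rewrite /C take_cat ltnNge (ltnW us) /=.
  rewrite (_ : size u - 2 - size s = c.+1) /=; last by lia.
  by rewrite takel_cat ?size_nseq ?take_nseq //; lia.
apply: (chunk_cat (r := nseq (e.+2 - c) g) cx).
  by rewrite /C -!catA /= -nseqD subnKC //; lia.
by rewrite size_cat /= size_nseq; lia.
Qed.

Lemma chunks_nspl m x U n x' U' n' u r :
  chunks m x U n x' U' n' -> g \notin u -> 0 < r -> starts (u ++ nseq r g) x ->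
  size u + r <= m -> (forall e s, u <> C e s) -> starts (u ++ nseq r g) x'.
Proof.
case=> cx cx' b gu r0 su um H; have [eu rn] := chunk_pure cx gu r0 su um.
subst u; have [|eU en] := blk_nsp b; first by left.
subst; apply: (chunk_cat (r := nseq (n' - r) g) cx').
  by rewrite -catA -nseqD subnKC.
by rewrite size_cat size_nseq.
Qed.

Lemma chunks_nspr m x U n x' U' n' u r :
  chunks m x U n x' U' n' -> g \notin u -> 0 < r -> starts (u ++ nseq r g) x' ->
  size u + r <= m -> (forall e s, u <> C e s) -> starts (u ++ nseq r g) x.
Proof.
case=> cx cx' b gu r0 su um H; have [eu rn] := chunk_pure cx' gu r0 su um.
subst u; have [|eU en] := blk_nsp b; first by right.
subst; apply: (chunk_cat (r := nseq (n' - r) g) cx).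
  by rewrite -catA -nseqD subnKC.
by rewrite size_cat size_nseq.
Qed.

Lemma chunks_shiftl m x U n x' U' n' e s r :
  chunks m x U n x' U' n' -> g \notin C e.+1 s -> 0 < r ->
  starts (C e.+1 s ++ nseq r g) x -> size s + e.+2 + r <= m ->
  starts (C e s ++ nseq r g) x'.
Proof.
case=> cx cx' b gu r0 su; rewrite -size_C => um.
have [eu rn] := chunk_pure cx gu r0 su um; rewrite -eu in b.
case: n b rn {cx} => [|n]; first by lia.
move=> /blk_Cl[? ?] rn; subst; apply: (chunk_cat (r := nseq (n.+2 - r) g) cx').
  by rewrite -catA -nseqD subnKC //; lia.
by move: um; rewrite size_cat !size_C size_nseq; lia.
Qed.

(** The run of [g] has length [n >= r], and its image begins with [s k a^(n-2)]; the known part of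
    the run guarantees [r - 2] of these letters [a]. *)
Lemma chunks_wrapl m x U n x' U' n' s r :
  chunks m x U n x' U' n' -> g \notin C 0 s -> 1 < r ->
  starts (C 0 s ++ nseq r g) x -> size s + 1 + r <= m ->
  starts (s ++ k :: nseq (r - 2) a) x'.
Proof.
case=> cx cx' b gu r1 su; rewrite -(size_C 0) => um.
have [eu rn] := chunk_pure cx gu (ltnW r1) su um; rewrite -eu in b.
case: n b rn {cx} => [|[|n]]; [by lia|by lia|].
move=> /blk_Cl[? ?] rn; subst.
apply: (chunk_cat (r := nseq (n - (r - 2)) a ++ k :: nseq 1 g) cx').
  rewrite CS [in LHS](_ : n = r - 2 + (n - (r - 2))); last by lia.
  by rewrite nseqD -!catA /= -!catA.
by move: um; rewrite size_cat !size_C /= size_nseq; lia.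
Qed.

(** [1 < r] rules out the images of [blk_wrap] and [blk_short], whose run of [g] has length 1. *)
Lemma chunks_shiftr m x U n x' U' n' e s r :
  chunks m x U n x' U' n' -> g \notin C e s -> 1 < r ->
  starts (C e s ++ nseq r g) x' -> size s + e.+1 + r <= m ->
  starts (C e.+1 s ++ nseq r.-1 g) x.
Proof.
case=> cx cx' b gu r1 su; rewrite -size_C => um.
have [eu rn] := chunk_pure cx' gu (ltnW r1) su um; rewrite -eu in b.
case: n' b rn {cx'} => [|[|n']]; [by lia|by lia|].
move=> /blk_Cr b rn; have {b} [? ?] : U = C e.+1 s /\ n = n'.+1 by case: e b {gu su um eu}.
subst; apply: (chunk_cat (r := nseq (n'.+1 - r.-1) g) cx).
  by rewrite -catA -nseqD subnKC //; lia.
by move: um; rewrite size_cat !size_C size_nseq; lia.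
Qed.

End Blocks.

(** * Distortion of surviving times *)

(** What the gasket conditions and the isolation of gamma give for contacts of first-level cells.
    [corner_boundary] says that corner [p] of cell [p], a corner of the whole space, is shared with
    no other cell. *)
Record corner_rel (L : Type) (g : L) (E : L -> L -> L -> L -> Prop) : Prop :=
  CornerRel {
    corner_neq : forall i p j q, E i p j q -> i <> j;
    corner_sym : forall i p j q, E i p j q -> E j q i p;
    corner_trans : forall i p j q l r, E i p j q -> E j q l r ->
      (i = l /\ p = r) \/ E i p l r;
    corner_boundary : forall p j q, ~ E p p j q;
    corner_isolated : forall p j q, ~ E g p j q }.

(** The contacts of [M'], with [t] for tau and [g] for gamma. *)
Definition detach (L : Type) (g t : L) (E : L -> L -> L -> L -> Prop) i p j q :=
  [/\ E i p j q, ~ (i = t /\ p = g) & ~ (j = t /\ q = g)].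

Lemma corner_rel_detach (L : Type) (g t : L) E :
  corner_rel g E -> corner_rel g (detach g t E).
Proof.
case=> E1 E2 E3 E4 E5; split.
- by move=> i p j q [/E1].
- by move=> i p j q [/E2].
- by move=> i p j q l r [/E3 H ? _] [/H[]]; [left|right].
- by move=> p j q [/E4].
- by move=> p j q [/E5].
Qed.

(** Reflexive closure of [E] on corners; for a corner relation it is an equivalence. *)
Definition meet (L : Type) (E : L -> L -> L -> L -> Prop) i p j q :=
  (i = j /\ p = q) \/ E i p j q.

Lemma meet_sym (L : Type) (g : L) E i p j q :
  corner_rel g E -> meet E i p j q -> meet E j q i p.
Proof. by case=> _ H _ _ _ [[-> ->]|/H]; [left|right]. Qed.

Lemma meet_trans (L : Type) (g : L) E i p j q l r :
  corner_rel g E -> meet E i p j q -> meet E j q l r -> meet E i p l r.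
Proof.
by case=> _ _ H _ _ [[-> ->]//|Eij] [[<- <-]|/(H _ _ _ _ _ _ Eij)//]; right.
Qed.

Lemma surv_meet (L : eqType) (E : L -> L -> L -> L -> Prop) u i p j q r x y :
  meet E i p j q -> starts (u ++ i :: nseq r p) x ->
  starts (u ++ j :: nseq r q) y -> surv E x y (size u + r.+1).
Proof.
case=> [[<- <-] sx sy|]; last exact: surv_corner.
rewrite (_ : _ + _ = size (u ++ i :: nseq r p)); first exact: surv_agree.
by rewrite size_cat /= size_nseq.
Qed.

Section Detach.
Variables (L : eqType) (g a t k : L) (E : L -> L -> L -> L -> Prop).
Hypothesis E_rel : corner_rel g E.
Hypothesis E_free : forall j q, ~ E k g j q.
Hypothesis E_touch : E t g k a.
Implicit Types (x y z : nat -> L) (s u w U V : seq L).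

Let E' := detach g t E.
Local Notation C := (C a t k).
Local Notation near := (near g a t k).
Local Notation chunks := (chunks g a t k).

Let E_sym := corner_sym E_rel.

Let ka : k <> a.
Proof. by move=> e; have := E_sym E_touch; rewrite e => /(corner_boundary E_rel). Qed.

Let tk : t <> k.
Proof. exact: corner_neq E_rel _ _ _ _ E_touch. Qed.

Let E_g i p j q : E i p j q -> i <> g /\ j <> g.
Proof.
move=> H; split=> e; subst.
  exact: corner_isolated E_rel _ _ _ H.
exact: corner_isolated E_rel _ _ _ (E_sym H).
Qed.

Let E_bd i p j q : E i p j q -> i <> p.
Proof. by move=> + e; rewrite e => /(corner_boundary E_rel). Qed.

Lemma nspecial u i : i <> t -> i <> k -> forall e s, u ++ [:: i] <> C e s.
Proof. by move=> it ik e s /C_last []. Qed.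

(** The cells [s k a^e] and [s t g^e] touch by [E_touch]. If both words take the second form,
    [k <> a] makes their [s] and [e] agree. *)
Lemma near_surv w x y : near w x -> near w y -> surv E x y (size w).
Proof.
have sz s e : size (s ++ k :: nseq e a) = size s + e.+1.
  by rewrite size_cat /= size_nseq.
case=> [sx|[s [e [ew sx]]]] [sy|[s' [e' [ew' sy]]]].
- exact: surv_agree.
- by rewrite ew' in sx *; rewrite sz; apply: surv_corner (E_sym E_touch) _ _.
- by rewrite ew in sy *; rewrite sz; apply: surv_corner E_touch _ _.
have [ee es] : e' = e /\ s' = s.
  have := congr1 rev ew'; rewrite ew !rev_cat_nseq.
  by case/(nseq_cat_inj ka ka) => -> _ /(inv_inj revK) ->.
subst e' s'; rewrite ew sz; rewrite (_ : size s + e.+1 = size (s ++ t :: nseq e g)).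
  exact: surv_agree.
by rewrite size_cat /= size_nseq.
Qed.

(** If [r <= 1], the run is dropped together with two letters of [u], which gives the loss 3. Longer
    runs lose less: nothing for ordinary blocks, one letter for a shift, two for a wrap. *)
Lemma agree_lip_l m x U n x' U' n' y V l y' V' l' u r :
  chunks m x U n x' U' n' -> chunks m y V l y' V' l' -> g \notin u ->
  starts (u ++ nseq r g) x -> starts (u ++ nseq r g) y -> size u + r <= m ->
  surv E' x' y' (size u + r - 3).
Proof.
move=> cx cy gu sx sy um.
have agree w : size u + r - 3 <= size w -> starts w x' -> starts w y' ->
    surv E' x' y' (size u + r - 3).
  by move=> Hw Hx Hy; apply: survW Hw _; apply: surv_agree.
have free : r <= 1 -> surv E' x' y' (size u + r - 3).
  move=> r1; apply: (agree (take (size u - 2) u)).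
  - by rewrite size_takel //; lia.
  - by apply: (chunks_freel cx gu (starts_catl sx)); lia.
  - by apply: (chunks_freel cy gu (starts_catl sy)); lia.
case: (leqP r 1) => [//|r1]; have r0 := ltnW r1.
have [[[|e] [s eu]]|H] := special_or_not a t k u; last first.
- apply: (agree (u ++ nseq r g)); first by rewrite size_cat size_nseq; lia.
    exact: (chunks_nspl cx).
  exact: (chunks_nspl cy).
- subst u; apply: (agree (C e s ++ nseq r g)).
  + by rewrite size_cat !size_C size_nseq; lia.
  + by apply: (chunks_shiftl ka tk cx) => //; rewrite -(size_C a t k).
  + by apply: (chunks_shiftl ka tk cy) => //; rewrite -(size_C a t k).
- subst u; apply: (agree (s ++ k :: nseq (r - 2) a)).
  + by rewrite size_cat size_C /= size_nseq; lia.
  + by apply: (chunks_wrapl ka tk cx) => //; rewrite -(size_C a t k 0).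
  + by apply: (chunks_wrapl ka tk cy) => //; rewrite -(size_C a t k 0).
Qed.

(** The same count backwards, with [near] in place of common prefixes; for special blocks [1 < r]
    leaves only the shift. *)
Lemma agree_lip_r m x U n x' U' n' y V l y' V' l' u r :
  chunks m x U n x' U' n' -> chunks m y V l y' V' l' -> g \notin u ->
  starts (u ++ nseq r g) x' -> starts (u ++ nseq r g) y' -> size u + r <= m ->
  surv E x y (size u + r - 3).
Proof.
move=> cx cy gu sx sy um.
have agree w : size u + r - 3 <= size w -> near w x -> near w y ->
    surv E x y (size u + r - 3).
  by move=> Hw Hx Hy; apply: survW Hw _; apply: near_surv.
have free : r <= 1 -> surv E x y (size u + r - 3).
  move=> r1; apply: (agree (take (size u - 2) u)).
  - by rewrite size_takel //; lia.
  - by apply: (chunks_freer cx gu (starts_catl sx)); lia.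
  - by apply: (chunks_freer cy gu (starts_catl sy)); lia.
case: (leqP r 1) => [//|r1]; have r0 := ltnW r1.
have [[e [s eu]]|H] := special_or_not a t k u; last first.
- apply: (agree (u ++ nseq r g)); first by rewrite size_cat size_nseq; lia.
    by left; apply: (chunks_nspr cx).
  by left; apply: (chunks_nspr cy).
- subst u; apply: (agree (C e.+1 s ++ nseq r.-1 g)).
  + by rewrite size_cat !size_C size_nseq; lia.
  + by left; apply: (chunks_shiftr ka tk cx) => //; rewrite -(size_C a t k).
  + by left; apply: (chunks_shiftr ka tk cy) => //; rewrite -(size_C a t k).
Qed.

Lemma notin_corner u i p r : g \notin u -> i <> g -> p <> g ->
  g \notin u ++ i :: nseq r p.
Proof.
move=> gu ig pg; rewrite mem_cat in_cons mem_nseq negb_or gu /=.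
by apply/negP => /orP[/eqP/esym|/andP[_ /eqP/esym]].
Qed.

Lemma take_corner u i p r n : n <= r ->
  take (size u + (r - n).+1) (u ++ i :: nseq r p) = u ++ i :: nseq (r - n) p.
Proof.
by move=> nr; rewrite take_cat ltnNge leq_addr /= addKn /= take_nseq // leq_subr.
Qed.

(** Only contacts at corner [g] of [t] have to move: [u t g^r] becomes [u k a^(r-2)], the same
    corner for [E] but not a detached one. If [p = g] and [i <> t], then [E_free] excludes [i = k],
    so the block is not special. *)
Lemma corner_l m x U n x' U' n' u i p j q r :
  chunks m x U n x' U' n' -> g \notin u -> E i p j q -> 1 < r ->
  starts (u ++ i :: nseq r p) x -> size u + r.+1 <= m ->
  exists i' p', [/\ starts (u ++ i' :: nseq (r - 2) p') x', meet E i p i' p' &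
    ~ (i' = t /\ p' = g)].
Proof.
move=> cx gu Eij r1 sx um; have [ig _] := E_g Eij.
case: (pselect (p = g)) => [pg|pg]; last first.
  exists i, p; split; [|by left|by case].
  have := chunks_freel cx (notin_corner r gu ig pg) sx.
  rewrite size_cat /= size_nseq => /(_ um).
  by rewrite (_ : _ - 2 = size u + (r - 2).+1) ?take_corner //; lia.
subst p; rewrite -cat1s catA in sx.
have gui : g \notin u ++ [:: i] := notin_corner 0 gu ig ig.
case: (pselect (i = t)) => [it|it].
  subst i; exists k, a; split; [|by right|by case=> /esym/tk].
  by apply: (chunks_wrapl ka tk cx) => //; rewrite addnAC; lia.
have ik : i <> k by move=> ik; subst i; apply: E_free Eij.
exists i, g; split; [|by left|by case].
have := chunks_nspl cx gui (ltnW r1) sx.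
rewrite size_cat /= => /(_ ltac:(lia) (nspecial it ik)) /(@starts_take _ _ _ (size u + (r - 2).+1)).
by rewrite -catA /= take_corner.
Qed.

(** Comparison from the right; the second alternative is [e = 0]. *)
Lemma run_cases u i c p s e : i <> p -> 0 < c ->
  u ++ i :: nseq c p = s ++ k :: nseq e a ->
  [/\ e = c, s = u, i = k & p = a] \/ s = u ++ i :: nseq c.-1 p.
Proof.
move=> ip c0 /(congr1 rev); rewrite !rev_cat_nseq.
case: c c0 e => [//|c] _ [|e].
  by case=> _ /(congr1 rev); rewrite revK rev_cat rev_cons rev_nseq revK cat_rcons; right.
move=> H; have pa : p = a by case: H.
by subst p; case/(nseq_cat_inj ip ka): H => -> -> /(inv_inj revK) ->; left.
Qed.

(** The loss is 3 rather than 2 because a [near] word [s k] guarantees only [s]. If the cell is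
    [u k a^(r-2)], the preimage may follow [u t g^(r-2)] instead, which has the same corner for
    [E]. *)
Lemma corner_r m x U n x' U' n' u i p j q r :
  chunks m x U n x' U' n' -> g \notin u -> E' i p j q -> 2 < r ->
  starts (u ++ i :: nseq r p) x' -> size u + r.+1 <= m ->
  exists i' p', starts (u ++ i' :: nseq (r - 3) p') x /\ meet E i p i' p'.
Proof.
move=> cx gu [Eij it jt] r2 sx um; have [ig _] := E_g Eij.
case: (pselect (p = g)) => [pg|pg]; last first.
  have := chunks_freer cx (notin_corner r gu ig pg) sx.
  rewrite size_cat /= size_nseq => /(_ um).
  rewrite (_ : _ - 2 = size u + (r - 2).+1) ?take_corner //; [|lia|lia].
  have e3 : r - 3 = r - 2 - 1 by lia.
  case=> [/(@starts_take _ _ _ (size u + (r - 2 - 1).+1))|[s [e [ew sxa]]]].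
    by rewrite take_corner -?e3; [exists i, p; split=> //; left|lia].
  have r20 : 0 < r - 2 by lia.
  have [[ee es ik pa]|es] := run_cases (E_bd Eij) r20 ew.
    subst e s i p; exists t, g; split; last by right; apply: E_sym.
    move: (starts_take (size u + (r - 2 - 1).+1) sxa).
    by rewrite take_corner -?e3; last lia.
  have e4 : (r - 2).-1 = r - 3 by lia.
  by move: (starts_catl sxa); rewrite es e4; exists i, p; split=> //; left.
subst p; exists i, g; split; last by left.
rewrite -cat1s catA in sx.
have gui : g \notin u ++ [:: i] := notin_corner 0 gu ig ig.
have ik : i <> k by move=> ik; subst i; apply: E_free Eij.
have it' : i <> t by move=> e; apply: it.
have := chunks_nspr cx gui (ltnW (ltnW r2)) sx.
rewrite size_cat /= => /(_ ltac:(lia) (nspecial it' ik)).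
move=> /(@starts_take _ _ _ (size u + (r - 3).+1)).
by rewrite -catA /= take_corner //; lia.
Qed.

Lemma chunks_lip_l m x U n x' U' n' y V l y' V' l' :
  chunks m x U n x' U' n' -> chunks m y V l y' V' l' ->
  (U = V -> n = l -> m <= size U + n) -> surv E x y m -> surv E' x' y' (m - 6).
Proof.
move=> cx cy same sxy; have [cx1 _ _] := cx; have [cy1 _ _] := cy.
have [[u [r [gu um sx sy]]]|] := surv_split E_g cx1 cy1 same sxy.
  apply: (@survW _ _ _ _ (size u + r - 3)); first by lia.
  by apply: (agree_lip_l cx cy gu sx sy); rewrite um.
move=> [u [i [p [j [q [r [gu Eij um sx sy]]]]]]].
case: (leqP r 1) => r1.
  apply: (@survW _ _ _ _ (size u + 0 - 3)); first by lia.
  apply: (agree_lip_l cx cy gu); rewrite ?cats0; last by lia.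
    exact: starts_catl sx.
  exact: starts_catl sy.
have [i1 [p1 [sx1 M1 N1]]] := corner_l cx gu Eij r1 sx (eq_leq um).
have [j1 [q1 [sy1 M2 N2]]] := corner_l cy gu (E_sym Eij) r1 sy (eq_leq um).
(* Each image cell keeps its original corner, so the two meet; [N1] and [N2] ensure that [detach]
   does not remove this contact. *)
have M : meet E i1 p1 j1 q1.
  apply: (meet_trans E_rel) M2; apply: (meet_trans E_rel (meet_sym E_rel M1)).
  by right.
apply: (@survW _ _ _ _ (size u + (r - 2).+1)); first by lia.
by apply: surv_meet sx1 sy1; case: M; [left|right; split].
Qed.

Lemma chunks_lip_r m x U n x' U' n' y V l y' V' l' :
  chunks m x U n x' U' n' -> chunks m y V l y' V' l' ->
  (U' = V' -> n' = l' -> m <= size U' + n') ->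
  surv E' x' y' m -> surv E x y (m - 6).
Proof.
move=> cx cy same sxy; have [_ cx1 _] := cx; have [_ cy1 _] := cy.
have E'_g i p j q : E' i p j q -> i <> g /\ j <> g by case=> /E_g.
have [[u [r [gu um sx sy]]]|] := surv_split E'_g cx1 cy1 same sxy.
  apply: (@survW _ _ _ _ (size u + r - 3)); first by lia.
  by apply: (agree_lip_r cx cy gu sx sy); rewrite um.
move=> [u [i [p [j [q [r [gu Eij um sx sy]]]]]]].
(* Here [m <= size u + 3], and agreement on [u] alone costs another 3; hence the loss 6. *)
case: (leqP r 2) => r2.
  apply: (@survW _ _ _ _ (size u + 0 - 3)); first by lia.
  apply: (agree_lip_r cx cy gu); rewrite ?cats0; last by lia.
    exact: starts_catl sx.
  exact: starts_catl sy.
have E'_sym := corner_sym (corner_rel_detach t E_rel).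
have [i1 [p1 [sx1 M1]]] := corner_r cx gu Eij r2 sx (eq_leq um).
have [j1 [q1 [sy1 M2]]] := corner_r cy gu (E'_sym _ _ _ _ Eij) r2 sy (eq_leq um).
have M : meet E i1 p1 j1 q1.
  apply: (meet_trans E_rel) M2; apply: (meet_trans E_rel (meet_sym E_rel M1)).
  by right; case: Eij.
apply: (@survW _ _ _ _ (size u + (r - 3).+1)); first by lia.
exact: surv_meet M sx1 sy1.
Qed.

End Detach.

(** * Recoding infinite words block by block *)

Section Blockwise.
Variables (L : eqType) (g : L) (bl : seq L -> nat -> seq L -> nat -> Prop).
Implicit Types (x y z : nat -> L) (s u w U V : seq L).

Definition linked m x U n x' U' n' :=
  [/\ chunk g m x U n, chunk g m x' U' n' & bl U n U' n'].

(* For words in which no run of [g] ends; one approximation per length [m]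
   allows [s t g^oo] to be paired with [s k a^oo]. *)
Definition unbounded x x' := forall m, exists U n U' n',
  linked m x U n x' U' n' /\ m <= size U + n.

Definition bounded (R : (nat -> L) -> (nat -> L) -> Prop) x x' :=
  exists U n U' n' y y', [/\ bl U n U' n', 0 < n, g \notin U /\ g \notin U',
    x = catw (U ++ nseq n g) y /\ x' = catw (U' ++ nseq n' g) y' &
    [/\ y 0 <> g, y' 0 <> g & R y y']].

(** Step-indexed form of a coinductive relation: [N] counts unfolded blocks, each of which has at
    least one letter. *)
Fixpoint blockwise N x x' : Prop :=
  if N is N'.+1 then unbounded x x' \/ bounded (blockwise N') x x' else True.

Hypothesis bl_size : forall U n U' n', bl U n U' n' -> size U + n = size U' + n'.
Hypothesis bl_pos : forall U n U' n', bl U n U' n' -> 0 < n -> 0 < n'.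
Hypothesis bl_fun : forall U n U1 n1 U2 n2,
  bl U n U1 n1 -> bl U n U2 n2 -> U1 = U2 /\ n1 = n2.

Lemma chunk_catw m U n y : g \notin U -> 0 < n -> y 0 <> g ->
  chunk g m (catw (U ++ nseq n g) y) U n.
Proof.
move=> gU n0 y0; split=> //; first by apply: starts_take; apply: starts_catw.
have e : size (U ++ nseq n g) = size U + n by rewrite size_cat size_nseq.
by right; split=> //; rewrite -e -[size _]addn0 catw_ge.
Qed.

Section Lipschitz.
Variables (F F' : L -> L -> L -> L -> Prop) (c : nat).
Hypothesis F_neq : forall i p j q, F i p j q -> i <> j.
Hypothesis F'_neq : forall i p j q, F' i p j q -> i <> j.
Hypothesis linked_lip : forall m x U n x' U' n' y V l y' V' l',
  linked m x U n x' U' n' -> linked m y V l y' V' l' ->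
  (U = V -> n = l -> m <= size U + n) -> surv F x y m -> surv F' x' y' (m - c).

(** A complete block common to [x] and [y] has a common image of the same length, and both are
    stripped. The first blocks that differ or reach [m + c] are left to [linked_lip], so the loss
    [c] is paid once. *)
Lemma blockwise_lip N x x' y y' m : blockwise N x x' -> blockwise N y y' ->
  m <= N -> surv F x y (m + c) -> surv F' x' y' m.
Proof.
elim: N x x' y y' m => [|N IH] x x' y y' m.
  by rewrite leqn0 => _ _ /eqP-> _; left.
move=> Hx Hy mN sxy.
have linkable z z' : unbounded z z' \/ bounded (blockwise N) z z' ->
    exists U n U' n', linked (m + c) z U n z' U' n' /\
      (m + c <= size U + n \/ exists (v v' : nat -> L), [/\ 0 < n, z = catw (U ++ nseq n g) v,
        z' = catw (U' ++ nseq n' g) v' & blockwise N v v']).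
  case=> [/(_ (m + c)) [U [n [U' [n' [H1 H2]]]]]|].
    by exists U, n, U', n'; split=> //; left.
  case=> U [n [U' [n' [w [w' [b n0 [gU gU'] [-> ->] [w0 w0' H]]]]]]].
  exists U, n, U', n'; split; last by right; exists w, w'.
  by split=> //; apply: chunk_catw => //; apply: bl_pos b n0.
have [U [n [U' [n' [lx Hlx]]]]] := linkable _ _ Hx.
have [V [l [V' [l' [ly Hly]]]]] := linkable _ _ Hy.
have lip : (U = V -> n = l -> m + c <= size U + n) -> surv F' x' y' m.
  by move=> /(linked_lip lx ly)/(_ sxy); rewrite addnK.
case: (leqP (m + c) (size U + n)) => [le_m|lt_m]; first by apply: lip.
case: (pselect (U = V /\ n = l)) => [[? ?]|H]; last by apply: lip => eU en; case: H.
subst V l; case: Hlx => [|[w [w' [n0 ex ex' Hw]]]]; first by lia.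
case: Hly => [|[v [v' [_ ey ey' Hv]]]]; first by lia.
have [_ _ bx] := lx; have [_ _ by_] := ly.
have [eU en] := bl_fun bx by_.
subst x x' y y' V' l'; rewrite (surv_catw F'_neq).
move: sxy; rewrite (surv_catw F_neq) !size_cat !size_nseq -(bl_size bx) => sxy.
case: (leqP (size U + n) m) => le_m.
  apply: IH Hw Hv _ _; first by lia.
  by move: sxy; rewrite (_ : m + c - _ = m - (size U + n) + c) //; lia.
by rewrite (_ : m - _ = 0); [left|lia].
Qed.

End Lipschitz.

Hypothesis bl_nil : forall U n n', bl U n [::] n' -> U = [::].
Hypothesis bl_total : forall U n, g \notin U -> 0 < n ->
  exists U' n', g \notin U' /\ bl U n U' n'.
Hypothesis bl0 : forall U, bl U 0 U 0.
Hypothesis unbounded_total : forall U, g \notin U ->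
  exists x', unbounded (catw U (fun=> g)) x'.

(** Keeps the run of [g] that closes an image block maximal when the image of the rest is
    appended. *)
Lemma unbounded_head x x' : unbounded x x' -> x 0 <> g -> x' 0 <> g.
Proof.
move=> /(_ 1) [U [n [U' [n' [[cx cx' b] Un]]]]] x0 x0'; apply: x0.
have eU' : U' = [::].
  by case: U' cx' {b} => // i U' cx'; case: (chunk_U cx' (i := 0)).
move: b Un cx; rewrite eU' => /bl_nil -> Un cx.
by apply: (chunk_G cx).
Qed.

Lemma first_boundary x :
  (exists U n y, [/\ g \notin U, 0 < n, x = catw (U ++ nseq n g) y & y 0 <> g]) \/
  (exists U, g \notin U /\ x = catw U (fun=> g)) \/ (forall i, x i <> g).
Proof.
case: (pselect (exists i, x i == g)) => [Hi|H]; last first.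
  by right; right=> i /eqP e; apply: H; exists i.
pose b := ex_minn Hi.
have [xb lt_b] : x b = g /\ forall i, i < b -> x i <> g.
  rewrite /b; case: ex_minnP => j /eqP xj Hj; split=> // i ij /eqP xi.
  by have := Hj _ xi; lia.
have gU : g \notin mkseq x b.
  apply/mapP => -[i]; rewrite mem_iota => /andP[_ ib] e.
  by apply: (lt_b i ib).
have sU : size (mkseq x b) = b by rewrite size_mkseq.
case: (pselect (exists d, x (b + d) != g)) => [Hd|H].
  left; pose d := ex_minn Hd.
  have [xd lt_d] : x (b + d) <> g /\ forall i, i < d -> x (b + i) = g.
    rewrite /d; case: ex_minnP => j /eqP xj Hj; split=> // i ij.
    by apply/eqP/negPn/negP => xi; have := Hj _ xi; lia.
  exists (mkseq x b), d, (fun i => x (b + d + i)); split=> //.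
  - by case: (d) xd => //; rewrite addn0.
  - apply/funext => i; rewrite /catw size_cat size_nseq sU.
    case: ltnP => Hib; last by congr x; lia.
    rewrite nth_cat sU; case: ltnP => ib; first by rewrite nth_mkseq.
    by rewrite nth_nseq ifT; [rewrite -(lt_d (i - b)); [congr x|]|]; lia.
  - by rewrite addn0.
right; left; exists (mkseq x b); split=> //; apply/funext => i.
rewrite /catw sU; case: ltnP => ib; first by rewrite nth_mkseq.
apply/eqP/negPn/negP => xi; apply: H; exists (i - b).
by rewrite subnKC.
Qed.

Lemma blockwise_step x : (exists x', unbounded x x') \/
  (exists U n U' n' y, [/\ bl U n U' n', 0 < n, g \notin U /\ g \notin U',
    x = catw (U ++ nseq n g) y & y 0 <> g]).
Proof.
have [[U [n [y [gU n0 ex y0]]]]|[[U [gU ->]]|H]] := first_boundary x.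
- have [U' [n' [gU' b]]] := bl_total gU n0.
  by right; exists U, n, U', n', y.
- by left; apply: unbounded_total.
(* A word without [g] is paired with itself, by chunks with an empty run. *)
left; exists x => m; exists (mkseq x m), 0, (mkseq x m), 0.
have cx : chunk g m x (mkseq x m) 0.
  split; last by rewrite size_mkseq; left; lia.
    by apply/mapP => -[i _ e]; apply: (H i).
  by apply: starts_take; rewrite cats0 /starts size_mkseq.
by split=> //; rewrite size_mkseq; lia.
Qed.

(** Image blocks chosen by [sg] are concatenated. Each has at least one letter, so letter [i] is
    settled after [i + 1] unfoldings, and the diagonal [G] is the limit. *)
Lemma blockwise_total x : exists x', forall N, blockwise N x x'.
Proof.
pose T := ((nat -> L) + (seq L * nat * seq L * nat * (nat -> L)))%type.
pose ok x (o : T) := match o with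
  | inl x' => unbounded x x'
  | inr (U, n, U', n', y) => [/\ bl U n U' n', 0 < n, g \notin U /\ g \notin U',
    x = catw (U ++ nseq n g) y & y 0 <> g] end.
have [sg Hsg] : exists sg : (nat -> L) -> T, forall x, ok x (sg x).
  suff H z : exists o, ok z o by exists (fun z => sval (cid (H z))) => z; case: cid.
  have [[z' Hz']|[U [n [U' [n' [y Hy]]]]]] := blockwise_step z; first by exists (inl z').
  by exists (inr (U, n, U', n', y)).
pose fix it (N : nat) (z : nat -> L) {struct N} : nat -> L := if N is N'.+1 then
  match sg z with
  | inl z' => z'
  | inr (U, n, U', n', y) => catw (U' ++ nseq n' g) (it N' y) end else z.
have stable N N' z i : i < N -> i < N' -> it N z i = it N' z i.
  elim: N N' z i => [//|N IH] [//|N'] z i iN iN' /=.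
  case: (sg z) (Hsg z) => [//|[[[[U n] U'] n'] y] [b n0 _ _ _]].
  have n'0 := bl_pos b n0; rewrite /catw size_cat size_nseq.
  case: ltnP => Hi; first by apply: set_nth_default; rewrite size_cat size_nseq.
  by apply: IH; lia.
pose G z i := it i.+1 z i.
have GE z : match sg z with
    | inl z' => G z = z'
    | inr (U, n, U', n', y) => G z = catw (U' ++ nseq n' g) (G y) end.
  rewrite /G; case e: (sg z) (Hsg z) => [z'|[[[[U n] U'] n'] y]].
    by move=> _; apply/funext => i /=; rewrite e.
  case=> b n0 _ _ _; have n'0 := bl_pos b n0; apply/funext => i.
  rewrite [LHS]/= e /catw size_cat size_nseq.
  case: ltnP => Hi; first by apply: set_nth_default; rewrite size_cat size_nseq.
  by apply: stable; lia.
have G0 z : z 0 <> g -> G z 0 <> g.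
  move: (GE z) (Hsg z); case: (sg z) => [z' ->|[[[[U n] U'] n'] y] -> [b n0 [gU gU'] -> y0]].
    exact: unbounded_head.
  have n'0 := bl_pos b n0.
  rewrite /catw !size_cat !size_nseq !addn_gt0 n0 n'0 !orbT !nth_cat.
  case: U' b gU' => [/bl_nil -> _|i U' _] /=.
    by rewrite nth_nseq n0.
  by rewrite in_cons negb_or => /andP[/eqP ig _] _ e; apply: ig.
exists (G x) => N; elim: N x => [//|N IH] x /=.
move: (GE x) (Hsg x); case: (sg x) => [x' ->|[[[[U n] U'] n'] y] -> [b n0 gUU' ex y0]].
  by left.
by right; exists U, n, U', n', y, (G y); split=> //; split=> //; apply: G0.
Qed.

End Blockwise.

Lemma blockwise_flip (L : eqType) (g : L) bl N x x' :
  (forall U n U' n', bl U n U' n' -> size U + n = size U' + n') ->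
  (forall U n U' n', bl U n U' n' -> 0 < n -> 0 < n') ->
  blockwise g bl N x x' ->
  blockwise g (fun U n U' n' => bl U' n' U n) N x' x.
Proof.
move=> bl_size bl_pos; elim: N x x' => [//|N IH] x x' /= [H|]; [left|right].
  move=> m; have [U [n [U' [n' [[H1 H2 H3] H4]]]]] := H m.
  by exists U', n', U, n; split; [|rewrite -(bl_size _ _ _ _ H3)].
case: b => U [n [U' [n' [y [y' [b n0 [gU gU'] [-> ->] [y0 y0' /IH H]]]]]]].
by exists U', n', U, n, y', y; split=> //; apply: bl_pos b n0.
Qed.

(** * The recoding relation of a corner relation *)

Section Recode.
Variables (L : eqType) (g a t k : L) (E : L -> L -> L -> L -> Prop).
Hypothesis E_rel : corner_rel g E.
Hypothesis E_free : forall j q, ~ E k g j q.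
Hypothesis E_touch : E t g k a.
Implicit Types (x y z : nat -> L) (s u w U V : seq L).

Let E' := detach g t E.
Let bl := blk a t k.
Let bl' U n U' n' := bl U' n' U n.
Local Notation C := (C a t k).

Let ka : k <> a.
Proof. by move=> e; have := corner_sym E_rel E_touch; rewrite e => /(corner_boundary E_rel). Qed.

Let tk : t <> k.
Proof. exact: corner_neq E_rel _ _ _ _ E_touch. Qed.

Let gk : g <> k.
Proof. by move=> e; have := corner_sym E_rel E_touch; rewrite -e => /(corner_isolated E_rel). Qed.

Let gt : g <> t.
Proof. by move=> e; have := E_touch; rewrite -e => /(corner_isolated E_rel). Qed.

Let ga : g <> a.
Proof. by move=> e; have := corner_sym E_rel E_touch; rewrite -e => /E_free. Qed.

Lemma notin_C e s : (g \notin C e s) = (g \notin s).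
Proof.
rewrite mem_cat negb_or; case: e => [|e] /=; rewrite !inE ?mem_cat ?mem_nseq ?inE.
  by rewrite (introF eqP gt) andbT.
by rewrite (introF eqP gk) (introF eqP ga) andbF andbT.
Qed.

Lemma blk_pos U n U' n' : bl U n U' n' -> 0 < n -> 0 < n'.
Proof. by case. Qed.

Lemma blk_pos' U n U' n' : bl' U n U' n' -> 0 < n -> 0 < n'.
Proof. by case. Qed.

Lemma C_nil e s : [::] <> C e s.
Proof. by move=> /(congr1 size); rewrite size_C addnS. Qed.

Lemma blk_nil U n n' : bl U n [::] n' -> U = [::].
Proof. by move=> /blk_nsp [|-> //]; right; apply: C_nil. Qed.

Lemma blk_nil' U n n' : bl' U n [::] n' -> U = [::].
Proof. by move=> /blk_nsp [|-> //]; left; apply: C_nil. Qed.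

Lemma blk_total U n : g \notin U -> 0 < n ->
  exists U' n', g \notin U' /\ bl U n U' n'.
Proof.
move=> gU; case: n => // n _; have [[e [s eU]]|H] := special_or_not a t k U; last first.
  by exists U, n.+1; split=> //; apply: blk_id; right.
move: gU; rewrite eU notin_C => gs; case: e {eU} => [|e]; last first.
  by exists (C e s), n.+2; rewrite notin_C; split=> //; apply: blk_shift.
case: n => [|n]; first by exists (C 0 s), 1; rewrite notin_C; split=> //; apply: blk_short.
by exists (C n.+1 s), 1; rewrite notin_C; split=> //; apply: blk_wrap.
Qed.

Lemma blk_total' U n : g \notin U -> 0 < n ->
  exists U' n', g \notin U' /\ bl' U n U' n'.
Proof.
move=> gU; case: n => // n _; have [[e [s eU]]|H] := special_or_not a t k U; last first.
  by exists U, n.+1; split=> //; apply: blk_id; right.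
move: gU; rewrite eU notin_C => gs; case: n => [|n].
  case: e {eU} => [|e]; first by exists (C 0 s), 1; rewrite notin_C; split=> //; apply: blk_short.
  by exists (C 0 s), e.+2; rewrite notin_C; split=> //; apply: blk_wrap.
by exists (C e.+1 s), n.+1; rewrite notin_C; split=> //; apply: blk_shift.
Qed.

Lemma chunk_tail m U n : g \notin U -> m <= size U + n ->
  chunk g m (catw U (fun=> g)) U n.
Proof.
move=> gU mU; split=> //; last by left.
apply/starts_take/starts_cat_nseq; first exact: starts_catw.
by move=> i /andP[Ui _]; rewrite /catw ltnNge Ui.
Qed.

Lemma unbounded_id U : (forall e s, U <> C e s) -> g \notin U ->
  unbounded g bl (catw U (fun=> g)) (catw U (fun=> g)).
Proof.
move=> H gU m; exists U, m, U, m; split; last by lia.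
by split; [apply: chunk_tail|apply: chunk_tail|apply: blk_id; right] => //; lia.
Qed.

Lemma unbounded_shift e s : g \notin s ->
  unbounded g bl (catw (C e.+1 s) (fun=> g)) (catw (C e s) (fun=> g)).
Proof.
move=> gs m; exists (C e.+1 s), m.+1, (C e s), m.+2; split; last by lia.
by split; [apply: chunk_tail|apply: chunk_tail|apply: blk_shift]; rewrite ?notin_C //; lia.
Qed.

(** At stage [m] the block [s t g^(m+2)] wraps to [s k a^m k g], which agrees with [s k a^oo] on its
    first [m] letters. *)
Lemma unbounded_wrap s : g \notin s ->
  unbounded g bl (catw (C 0 s) (fun=> g)) (catw (s ++ [:: k]) (fun=> a)).
Proof.
move=> gs m; exists (C 0 s), m.+2, (C m.+1 s), 1; split; last by lia.
split; [by apply: chunk_tail; rewrite ?notin_C //; lia| |exact: blk_wrap].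
split; rewrite ?notin_C //; last by left; rewrite size_C; lia.
have -> : take m (C m.+1 s ++ nseq 1 g) = take m ((s ++ [:: k]) ++ nseq m a).
  have -> : C m.+1 s ++ nseq 1 g = ((s ++ [:: k]) ++ nseq m a) ++ [:: k; g].
    by rewrite /C -!catA /= -catA.
  by rewrite takel_cat // size_cat size_nseq leq_addl.
apply/starts_take/starts_cat_nseq; first exact: starts_catw.
by move=> i /andP[Ui _]; rewrite /catw ltnNge Ui.
Qed.

Lemma unbounded_total_l U : g \notin U ->
  exists x', unbounded g bl (catw U (fun=> g)) x'.
Proof.
move=> gU; have [[[|e] [s eU]]|H] := special_or_not a t k U; last first.
- by eexists; apply: unbounded_id.
- by move: gU; rewrite eU notin_C => gs; eexists; apply: unbounded_shift.
- by move: gU; rewrite eU notin_C => gs; eexists; apply: unbounded_wrap.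
Qed.

Lemma unbounded_flip x x' : unbounded g bl x' x -> unbounded g bl' x x'.
Proof.
move=> H m; have [U [n [U' [n' [[H1 H2 H3] H4]]]]] := H m.
by exists U', n', U, n; split; [|rewrite -(blk_size H3)].
Qed.

Lemma unbounded_total_r U : g \notin U ->
  exists x', unbounded g bl' (catw U (fun=> g)) x'.
Proof.
move=> gU; have [[e [s eU]]|H] := special_or_not a t k U; last first.
  by eexists; apply/unbounded_flip/unbounded_id.
by move: gU; rewrite eU notin_C => gs; eexists; apply/unbounded_flip/unbounded_shift.
Qed.

Lemma blk_size' U n U' n' : bl' U n U' n' -> size U + n = size U' + n'.
Proof. by move/blk_size. Qed.

Lemma blk_id0 U : bl U 0 U 0.
Proof. by apply: blk_id; left. Qed.

(** [Phi] is not injective on words: for [s] free of [g], both [s k a^oo] and [s t g^oo] are related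
    to [s k a^oo]. They are one point for [E], so the estimates still give a bijection of
    classes. *)
Lemma recoding : exists Phi : (nat -> L) -> (nat -> L) -> Prop,
  [/\ forall x, exists x', Phi x x', forall x', exists x, Phi x x',
    forall x x' y y' n, Phi x x' -> Phi y y' ->
      surv E x y (n + 6) -> surv E' x' y' n &
    forall x x' y y' n, Phi x x' -> Phi y y' ->
      surv E' x' y' (n + 6) -> surv E x y n].
Proof.
have En := corner_neq E_rel; have E'n := corner_neq (corner_rel_detach t E_rel).
exists (fun x x' => forall N, blockwise g bl N x x'); split.
- apply: blockwise_total blk_pos blk_nil blk_total blk_id0 unbounded_total_l.
- move=> x'; have [x Hx] := blockwise_total blk_pos' blk_nil' blk_total' blk_id0
    unbounded_total_r x'.
  by exists x => N; have := blockwise_flip blk_size' blk_pos' (Hx N).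
- move=> x x' y y' n Hx Hy.
  apply: (blockwise_lip (@blk_size _ a t k) blk_pos (blk_fun ka tk) En E'n _ (Hx n) (Hy n)) => //.
  by move=> *; apply: (chunks_lip_l E_rel E_free E_touch) => //; eassumption.
- move=> x x' y y' n Hx Hy.
  have Fx := blockwise_flip (@blk_size _ a t k) blk_pos (Hx n).
  have Fy := blockwise_flip (@blk_size _ a t k) blk_pos (Hy n).
  apply: (blockwise_lip blk_size' blk_pos' _ E'n En _ Fx Fy) => //.
    by move=> U m U1 n1 U2 n2 H1 H2; apply: (blk_inj ka tk H1 H2).
  move=> m z U l z' U' n' v V l1 v' V' l' [X1 X2 X3] [Y1 Y2 Y3].
  by apply: (chunks_lip_r E_rel E_free E_touch); split; eassumption.
Qed.

End Recode.

(** * Gasket automata *)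

Section Tail.
Variables (L : eqType) (g : L) (E : L -> L -> L -> L -> Prop).
Hypothesis E_rel : corner_rel g E.
Implicit Types x y z : nat -> L.

Lemma surv_sym x y n : surv E x y n -> surv E y x n.
Proof.
case=> [H|[d [p [q [dn H Hd Hr]]]]]; first by left=> i im; rewrite H.
right; exists d, q, p; split=> //.
- by move=> i im; rewrite H.
- exact: corner_sym E_rel _ _ _ _ Hd.
- by move=> i /Hr[].
Qed.

(* [corner_boundary] makes the corner shared by two words of a class end the
   run of any third word that meets one of them. *)
Lemma surv_tail x y z n :
  (forall N, surv E x y N) -> surv E y z (n + 2) -> surv E x z n.
Proof.
move=> xy yz; have bd u p j : ~ E u p j j.
  by move=> /(corner_sym E_rel)/(corner_boundary E_rel).
case: (pselect (forall i, x i = y i)) => [e|ne].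
  by have -> : x = y; [apply/funext|apply: survW yz; lia].
have [c xyc] : exists c, x c <> y c by apply/existsNP.
case: (xy (n + c + 3)) => [/(_ c)|[d [p [q [dN H Hd Hr]]]]]; first by move/(_ ltac:(lia)).
have dc : d <= c.
  by rewrite leqNgt; apply/negP => /H.
case: (leqP n d) => nd.
  case: yz => [Hz|[d2 [p2 [q2 [dn2 H2 Hd2 Hr2]]]]].
    by left=> i im; rewrite H ?Hz //; lia.
  case: (leqP n d2) => nd2; first by left=> i im; rewrite H ?H2 //; lia.
  right; exists d2, p2, q2; split=> //.
  - by move=> i im; rewrite H ?H2 //; lia.
  - by rewrite H //; lia.
  - by move=> i im; rewrite H; [apply: Hr2; lia|lia].
have Hr' i : d < i < n + 2 -> x i = p /\ y i = q by move=> Hi; apply: Hr; lia.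
(* The two extra steps in [n + 2] make the letter after a parting place below [n] available, which
   [corner_boundary] requires. *)
have [_ yd1] : x d.+1 = p /\ y d.+1 = q by apply: Hr'; lia.
case: yz => [Hz|[d2 [p2 [q2 [dn2 H2 Hd2 Hr2]]]]].
  right; exists d, p, q; split=> //.
  - by move=> i im; rewrite H ?Hz //; lia.
  - by rewrite -Hz //; lia.
  - by move=> i im; rewrite -Hz; [apply: Hr'; lia|lia].
case: (ltngtP d2 d) => dd.
- have [y1 _] : y d = p2 /\ z d = q2 by apply: Hr2; lia.
  have [y2 _] : y d.+1 = p2 /\ z d.+1 = q2 by apply: Hr2; lia.
  by move: Hd; rewrite y1 -yd1 y2 => /bd.
- have [_ y1] : x d2 = p /\ y d2 = q by apply: Hr'; lia.
  case: (leqP n d2) => nd2.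
    right; exists d, p, q; split=> //.
    + by move=> i im; rewrite H ?H2 //; lia.
    + by rewrite -H2 //; lia.
    + by move=> i im; rewrite -H2; [apply: Hr'; lia|lia].
  have [_ y2] : x d2.+1 = p /\ y d2.+1 = q by apply: Hr'; lia.
  have [y3 _] : y d2.+1 = p2 /\ z d2.+1 = q2 by apply: Hr2; lia.
  by case: (corner_boundary E_rel (p := q) (j := z d2) (q := q2)); rewrite -{1}y1 -y2 y3.
- subst d2; have [y1 _] : y d.+1 = p2 /\ z d.+1 = q2 by apply: Hr2; lia.
  have ep : p2 = q by rewrite -y1.
  rewrite ep in Hd2; case: (corner_trans E_rel Hd Hd2) => [[exz epq]|Exz].
    left=> i im; case: (ltngtP i d) => [id|id|-> //]; first by rewrite H // H2.
    have [-> _] := Hr' i ltac:(lia); have [_ ->] := Hr2 i ltac:(lia).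
    by [].
  right; exists d, p, q2; split=> //.
  + by move=> i im; rewrite H ?H2 //; lia.
  + by move=> i im; split; [case: (Hr' i) => //; lia|case: (Hr2 i) => //; lia].
Qed.

End Tail.

(** * Itineraries as contacts of cells *)

Definition realizes N (M : tri_data N) E :=
  forall x y n, itin M x y n <> Exit <-> surv E x y n.

(** In the state [S_uv] only the pair of labels of [v] and [u] survives, so the first word runs into
    corner [v] and the second into corner [u]. *)
Definition corners N (M : tri_data N) i p j q := exists u v,
  [/\ u != v, P M u v i j, lab M v = inl p & lab M u = inl q].

Section Itinerary.
Variables (N : nat) (M : tri_data N) (lb : 'I_3 -> 'I_N).
Hypothesis lbE : forall v, lab M v = inl (lb v).
Hypothesis M_irr : forall u v i, ~~ P M u v i i.
Hypothesis M_disj : forall u v u' v' i j, u != v -> u' != v' ->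
  P M u v i j -> P M u' v' i j -> u = u' /\ v = v'.

Lemma delta_Id u v i j : u != v -> P M u v i j -> delta M IdSt i j = St u v.
Proof.
move=> uv Pij /=; rewrite ifF; last first.
  by apply/eqP => ij; move: Pij; rewrite ij (negbTE (M_irr _ _ _)).
case: pickP => [[u' v'] /= /andP[uv' Pij']|/(_ (u, v))]; last by rewrite /= uv Pij.
by have [-> ->] := M_disj uv' uv Pij' Pij.
Qed.

Lemma realizes_corners : realizes M (corners M).
Proof.
move=> x y n.
have agreeE m : (forall i, i < m -> x i = y i) -> itin M x y m = IdSt.
  elim: m => [//|m IH] H /=; rewrite IH => [|i im]; last by apply: H; lia.
  by rewrite /= H // eqxx.
split=> [|[/agreeE -> //|[d [p [q [dn H [u [v [uv Pd lv lu]]] Hr]]]]]].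
  (* At [Id] the words agree so far; in a state [(u, v)] they parted at some [d] and have since
     followed the labels of [v] and [u]. *)
  have inv m : match itin M x y m return Prop with
    | Some (Some (u, v)) => u != v /\ exists d, [/\ d < m, 
        forall i, i < d -> x i = y i, P M u v (x d) (y d) &
        forall i, d < i < m -> x i = lb v /\ y i = lb u]
    | Some None => forall i, i < m -> x i = y i
    | None => True end.
    elim: m => [//|m] /=; case: (itin M x y m) => [[[u v]|]|] //=.
      move=> [uv [d [dm H Pd Hr]]]; rewrite !lbE; case: ifP => //.
      move=> /andP[/eqP[ev] /eqP[eu]]; split=> //; exists d; split=> //; first lia.
      move=> i; rewrite ltnS => /andP[di]; rewrite leq_eqVlt => /orP[/eqP ->|im] //.
      by apply: Hr; rewrite di.
    move=> H; case: ifP => [/eqP e i|ne].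
      by rewrite ltnS leq_eqVlt => /orP[/eqP ->|/H].
    case: pickP => [[u v] /andP[/= uv Pij]|//]; split=> //.
    by exists m; split=> // i; lia.
  move: (inv n); case: (itin M x y n) => [[[u v]|]|] //; last by left.
  move=> [uv [d [dn H Pd Hr]]] _; right; exists d, (lb v), (lb u); split=> //.
  by exists u, v.
suff runE m : d < m <= n -> itin M x y m = St u v by rewrite runE // dn leqnn.
elim: m => [//|m IH]; rewrite ltnS => /andP[dm mn].
move: dm; rewrite leq_eqVlt => /orP[/eqP dm|dm].
  subst m; rewrite [LHS]/= agreeE //; exact: delta_Id.
rewrite /= IH ?dm ?(ltnW mn) //= lv lu.
by have [-> ->] := Hr m ltac:(lia); rewrite !eqxx.
Qed.

End Itinerary.

Local Open Scope ring_scope.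

(** * From surviving times to the quotient metrics *)

Section Metric.
Variables (R : realType) (N : nat) (xi : R).
Hypothesis xi01 : 0 < xi < 1.
Implicit Types (M : tri_data N) (x y z a b : word N).

Let xi0 : 0 < xi. Proof. by case/andP: xi01. Qed.
Let xi1 : xi <= 1. Proof. by case/andP: xi01 => _ /ltW. Qed.

Lemma rho_cases M E x y : realizes M E ->
  ((forall n, surv E x y n) /\ rho M xi x y = 0) \/
  exists T, [/\ surv E x y T, ~ surv E x y T.+1 & rho M xi x y = xi ^+ T].
Proof.
move=> ME; rewrite /rho; case: pselect => [H|H]; [right|left].
  case: ex_minnP => m /eqP exm minm.
  (* The state at time 0 is [Id], so the first exit time is positive and [.-1] in [rho] is a true
     predecessor. *)
  case: m exm minm => [//|m] exm minm; exists m; split=> //.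
    by apply/ME => /eqP /minm; rewrite ltnn.
  by move/ME.
split=> // n; apply/ME => /eqP ex; by apply: H; exists n.
Qed.

Lemma rho_ge0 M E x y : realizes M E -> 0 <= rho M xi x y.
Proof.
by move=> /(rho_cases x y)[[_ ->]//|[T [_ _ ->]]]; rewrite exprn_ge0 // ltW.
Qed.

Lemma rho_eq0 M E x y : realizes M E -> rho M xi x y = 0 <-> forall n, surv E x y n.
Proof.
move=> /(rho_cases x y)[[H ->]//|[T [_ nT ->]]]; split=> [/eqP|/(_ T.+1)//].
by rewrite expf_eq0 gt_eqF // andbF.
Qed.

Lemma rho_le M M' E E' x y x' y' c : realizes M E -> realizes M' E' ->
  (forall n, surv E x y (n + c)%N -> surv E' x' y' n) ->
  rho M' xi x' y' <= xi^-1 ^+ c * rho M xi x y.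
Proof.
move=> ME ME' H.
have [[H' ->]|[T' [_ nT' ->]]] := rho_cases x' y' ME'.
  by rewrite mulr_ge0 ?(rho_ge0 _ _ ME) // exprn_ge0 // invr_ge0 ltW.
have [[H1 _]|[T [sT _ ->]]] := rho_cases x y ME; first by case: nT'; apply/H/H1.
rewrite exprVn mulrC ler_pdivlMr ?exprn_gt0 // -exprD ler_wiXn2l ?(ltW xi0) //.
rewrite leqNgt; apply/negP => lt_T; apply/nT'/H; apply: survW sT.
by rewrite addSn.
Qed.

Section OneAutomaton.
Variables (M : tri_data N) (g : 'I_N) (E : 'I_N -> 'I_N -> 'I_N -> 'I_N -> Prop).
Hypotheses (E_rel : corner_rel g E) (ME : realizes M E).

Lemma clsP x y : cls M xi x y <-> forall n, surv E x y n.
Proof. exact: rho_eq0. Qed.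

Lemma cls_refl x : cls M xi x x.
Proof. by apply/clsP => n; left. Qed.

Lemma surv_trans x y z : (forall n, surv E x y n) -> (forall n, surv E y z n) ->
  forall n, surv E x z n.
Proof. by move=> xy yz n; apply: (surv_tail E_rel xy). Qed.

Lemma cls_eqP x y : cls M xi x = cls M xi y <-> forall n, surv E x y n.
Proof.
split=> [e|xy]; first by apply/clsP; rewrite e; apply: cls_refl.
have yx n : surv E y x n by apply: surv_sym E_rel _ _ _ (xy n).
apply/funext => z; apply/propext; split=> /clsP H; apply/clsP.
  exact: surv_trans yx H.
exact: surv_trans xy H.
Qed.

(** By [surv_tail] each change of representative costs two steps of surviving time, and two
    representatives change; hence the exponent 4. *)
Lemma rho_t_bounds x y (A B : AM M xi) :
  sval A = cls M xi x -> sval B = cls M xi y ->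
  rho_t A B <= rho M xi x y <= xi^-1 ^+ 4 * rho_t A B.
Proof.
move=> eA eB; set S := [set r : R | exists a b, sval A a /\ sval B b /\ r = rho M xi a b]%classic.
have S_xy : S (rho M xi x y).
  by exists x, y; rewrite eA eB; split; [|split=> //]; apply: cls_refl.
have lb : lbound S (xi ^+ 4 * rho M xi x y).
  move=> r [a [b [Aa [Bb ->]]]]; rewrite eA in Aa; rewrite eB in Bb.
  rewrite mulrC -ler_pdivlMr ?exprn_gt0 // mulrC -exprVn.
  apply: rho_le ME ME _ => n ab.
  have xb : surv E x b (n + 2)%N.
    by apply: (surv_tail E_rel (y := a)); [exact/clsP|rewrite -addnA].
  apply: (surv_sym E_rel); apply: (surv_tail E_rel (y := b)); first exact/clsP.
  exact: (surv_sym E_rel).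
rewrite ge_inf //=; last by exists (xi ^+ 4 * rho M xi x y).
rewrite exprVn mulrC ler_pdivlMr ?exprn_gt0 // mulrC.
by apply: lb_le_inf => //; exists (rho M xi x y).
Qed.

End OneAutomaton.

(** The estimates make [Phi] respect classes in both directions, so choices made on either side are
    mutually inverse. *)
Lemma lipschitz_of_recoding M M' g E E' (Phi : word N -> word N -> Prop) c :
  corner_rel g E -> corner_rel g E' -> realizes M E -> realizes M' E' ->
  (forall x, exists x', Phi x x') -> (forall x', exists x, Phi x x') ->
  (forall x x' y y' n, Phi x x' -> Phi y y' ->
     surv E x y (n + c)%N -> surv E' x' y' n) ->
  (forall x x' y y' n, Phi x x' -> Phi y y' ->
     surv E' x' y' (n + c)%N -> surv E x y n) ->
  lipschitz_equiv M M' xi.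
Proof.
move=> Er E'r ME ME' tot sur fwd bwd.
have [f Hf] : exists f : AM M xi -> AM M' xi, forall A, exists x x',
    [/\ Phi x x', sval A = cls M xi x & sval (f A) = cls M' xi x'].
  suff H (A : AM M xi) : exists B : AM M' xi, exists x x',
      [/\ Phi x x', sval A = cls M xi x & sval B = cls M' xi x'].
    by exists (fun A => sval (cid (H A))) => A; case: cid.
  case: A => A [x eA]; have [x' Pxx'] := tot x.
  by exists (exist _ (cls M' xi x') (ex_intro _ x' erefl)), x, x'.
have [h Hh] : exists h : AM M' xi -> AM M xi, forall B, exists x x',
    [/\ Phi x x', sval (h B) = cls M xi x & sval B = cls M' xi x'].
  suff H (B : AM M' xi) : exists A : AM M xi, exists x x',
      [/\ Phi x x', sval A = cls M xi x & sval B = cls M' xi x'].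
    by exists (fun A => sval (cid (H A))) => A; case: cid.
  case: B => B [x' eB]; have [x Pxx'] := sur x'.
  by exists (exist _ (cls M xi x) (ex_intro _ x erefl)), x, x'.
have sval_eq (T : Type) (Q : T -> Prop) (u v : sig Q) : sval u = sval v -> u = v.
  by case: u v => u p [v q] /= e; apply: eq_exist.
exists f; split.
  exists h => [A|B]; apply: sval_eq.
    have [x [x' [Px eA efA]]] := Hf A; have [y [y' [Py eh ehf]]] := Hh (f A).
    rewrite eA eh; apply/(cls_eqP Er ME) => n; apply: (bwd _ _ _ _ _ Py Px).
    by move: (n + c)%N; apply/(cls_eqP E'r ME'); rewrite -efA -ehf.
  have [x [x' [Px ehB eB]]] := Hh B; have [y [y' [Py ehB' ef]]] := Hf (h B).
  rewrite eB ef; apply/(cls_eqP E'r ME') => n; apply: (fwd _ _ _ _ _ Py Px).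
  by move: (n + c)%N; apply/(cls_eqP Er ME); rewrite -ehB -ehB'.
have K0 m : 0 < xi^-1 ^+ m by rewrite exprn_gt0 // invr_gt0.
(* [c] comes from the recoding, 4 from comparing [rho] with the infimum [rho_t]. *)
exists (xi^-1 ^+ (c + 4)); split=> // A B.
have [x [x' [Px eA efA]]] := Hf A; have [y [y' [Py eB efB]]] := Hf B.
have /andP[b1 b2] := rho_t_bounds Er ME eA eB.
have /andP[b1' b2'] := rho_t_bounds E'r ME' efA efB.
split; last first.
  apply: le_trans b1' _; rewrite exprD -mulrA.
  apply: le_trans (rho_le ME ME' (fun n => fwd _ _ _ _ n Px Py)) _.
  by rewrite ler_pM2l.
rewrite -ler_pdivlMl ?invr_gt0 // invrK.
apply: le_trans b1 _; rewrite exprD -mulrA.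
apply: le_trans (rho_le ME' ME (fun n => bwd _ _ _ _ n Px Py)) _.
by rewrite ler_pM2l.
Qed.

End Metric.

(** * The corner relation of a gasket automaton *)

Section Gasket.
Variables (N : nat) (M : tri_data N) (lb : 'I_3 -> 'I_N).
Hypothesis lbE : forall v, lab M v = inl (lb v).
Hypothesis M_gasket : gasket M.

Lemma ord3 (v : 'I_3) : [\/ v = vA, v = vB | v = vC].
Proof.
case: v => [[|[|[|//]]]] H; [constructor 1|constructor 2|constructor 3]; exact: val_inj.
Qed.

Lemma P_flip u v i j : P M u v i j = P M v u j i.
Proof. by case: (ord3 u) (ord3 v) => -> [] ->. Qed.

Lemma lb_inj : injective lb.
Proof.
case: M_gasket => -[inj _] _ u v e; apply: inj.
by rewrite !lbE e.
Qed.

(** The three implications of Gathering, read with the vertices in every order, become one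
    composition rule. *)
Lemma gathering u v w i j l : u != v -> w != u -> w != v ->
  P M u v i j -> P M w u j l -> P M w v i l.
Proof.
case: M_gasket => _ [_ [gath _]].
have G1 p q r H1 H2 := (gath p q r).1 H1 H2.
have G2 p q r H1 H2 := (gath p q r).2.1 H1 H2.
have G3 p q r H1 H2 := (gath p q r).2.2 H1 H2.
by case: (ord3 u) (ord3 v) (ord3 w) => -> [] -> [] -> //= _ _ _; rewrite /P /=; eauto.
Qed.

Lemma boundary u v j : u != v -> ~~ P M u v (lb v) j.
Proof.
case: M_gasket => _ [_ [_ [HA [HB HC]]]].
have [HA1 HA2] := HA _ (lbE _); have [HB1 HB2] := HB _ (lbE _).
have [HC1 HC2] := HC _ (lbE _).
move=> uv; rewrite P_flip; case: (ord3 u) (ord3 v) uv => -> [] -> //.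
Qed.

(** For transitivity, distinct labels force [v' = u]; the second contact then either returns to the
    vertex [v], where Uniqueness applies, or composes with the first by Gathering. *)
Lemma corners_rel : (forall u v j, ~~ P M u v (lb vC) j) ->
  corner_rel (lb vC) (corners M).
Proof.
move=> iso; have [[_ [irr disj]] [uniq _]] := M_gasket; split.
- move=> i p j q [u [v [uv Pij _ _]]] ij.
  by move: Pij; rewrite ij (negbTE (irr _ _ _)).
- move=> i p j q [u [v [uv Pij lv lu]]]; exists v, u.
  by rewrite eq_sym uv -P_flip.
- move=> i p j q l r [u [v [uv Pij lv lu]]] [u' [v' [uv' Pjl lv' lu']]].
  have ev : v' = u.
    by apply: M_gasket.1.1; rewrite lv' lu.
  subst v'; case: (eqVneq u' v) => [e|ne].
    subst u'; left; split; last by move: lu'; rewrite lv => -[].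
    by apply: (uniq v u j) => //; rewrite 1?eq_sym // -P_flip.
  right; exists u', v; split=> //.
  exact: gathering Pij Pjl.
- move=> p j q [u [v [uv Pij lv lu]]].
  move: lv; rewrite lbE => -[e]; rewrite -e in Pij.
  by move: Pij; apply/negP; apply: boundary.
- by move=> p j q [u [v [uv Pij _ _]]]; move: Pij; apply/negP.
Qed.

End Gasket.

(** * The effect of a one-step simplification *)

Lemma P_detach N (M M' : tri_data N) tau :
  Pab M' =2 Pab M -> (forall i j, Pag M' i j = Pag M i j && (i != tau)) ->
  (forall i j, Pbg M' i j = Pbg M i j && (i != tau)) ->
  forall u v i j, P M' u v i j <->
    [/\ P M u v i j, ~ (i = tau /\ v = vC) & ~ (j = tau /\ u = vC)].
Proof.
move=> Eab Eag Ebg u v i j.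
case: (ord3 u) (ord3 v) => -> [] ->; rewrite /P /= ?Eab ?Eag ?Ebg; split;
  try by case.
- by move=> ->; split=> // -[].
- by case/andP=> -> /eqP it; split=> // -[].
- by case=> -> it _; rewrite andTb; apply/eqP => e; apply: it.
- by move=> ->; split=> // -[].
- by case/andP=> -> /eqP it; split=> // -[].
- by case=> -> it _; rewrite andTb; apply/eqP => e; apply: it.
- by case/andP=> -> /eqP it; split=> // -[].
- by case=> -> _ it; rewrite andTb; apply/eqP => e; apply: it.
- by case/andP=> -> /eqP it; split=> // -[].
- by case=> -> _ it; rewrite andTb; apply/eqP => e; apply: it.
Qed.

Lemma rm_source N (Q : rel 'I_N) (p q : 'I_N) :
  (forall j, Q p j -> j = q) -> forall i j, rm Q p q i j = Q i j && (i != p).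
Proof.
move=> H i j; rewrite /rm xpair_eqE negb_and; case Qij: (Q i j) => //=.
by case: (eqVneq i p) => //= ip; rewrite ip in Qij; rewrite (H _ Qij) eqxx.
Qed.

Lemma no_source N (Q : rel 'I_N) (p : 'I_N) :
  (forall j, ~~ Q p j) -> forall i j, Q i j = Q i j && (i != p).
Proof.
move=> H i j; case: (eqVneq i p) => [->|]; last by rewrite andbT.
by rewrite (negbTE (H j)).
Qed.

(** Every case deletes exactly the pairs that leave [tau] towards gamma. For [(tau, kappa)] in
    [Pag], Uniqueness makes it the only one there, and by Gathering a pair [(tau, j)] in [Pbg] gives
    [Pab j kappa], so [j] is the unique predecessor [l], if there is one. *)
Lemma simplification_detaches N (M M' : tri_data N) :
  gasket M -> one_step_simplification M M' ->
  exists tau kappa V, [/\ V != vC, P M V vC tau kappa, double_max M kappa &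
    forall u v i j, P M' u v i j <->
      [/\ P M u v i j, ~ (i = tau /\ v = vC) & ~ (j = tau /\ u = vC)]].
Proof.
move=> [_ [uniq [gath _]]] [_ [tau [kappa [dm H]]]].
have uag i j j' : Pag M i j -> Pag M i j' -> j = j' := uniq vA vC i j j' isT.
have ubg i j j' : Pbg M i j -> Pbg M i j' -> j = j' := uniq vB vC i j j' isT.
have uab i j j' : Pab M i j -> Pab M i j' -> j = j' := uniq vA vB i j j' isT.
have uba i j j' : Pab M j i -> Pab M j' i -> j = j' := uniq vB vA i j j' isT.
exists tau, kappa; case: H => [[Htk H]|[Htk H]].
  exists vA; split=> //; case: H => [[nol [Eab [Eag Ebg]]]|[l [Hl [Eab [Eag Ebg]]]]];
    apply: P_detach => // i j.
  - by rewrite Eag; apply: rm_source => j' H; apply: uag H Htk.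
  - rewrite Ebg; apply: no_source => j'; apply/negP => H.
    by move: ((gath _ _ _).1 Htk H); apply/negP.
  - by rewrite Eag; apply: rm_source => j' H; apply: uag H Htk.
  - rewrite Ebg; apply: rm_source => j' H.
    by apply: uba Hl; apply: (gath _ _ _).1 Htk H.
exists vB; split=> //; case: H => [[nol [Eab [Ebg Eag]]]|[l [Hl [Eab [Ebg Eag]]]]];
  apply: P_detach => // i j.
- rewrite Eag; apply: no_source => j'; apply/negP => H.
  by move: ((gath _ _ _).1 H Htk); apply/negP; apply: nol.
- by rewrite Ebg; apply: rm_source => j' H; apply: ubg H Htk.
- rewrite Eag; apply: rm_source => j' H.
  by apply: uab Hl; apply: (gath _ _ _).1 H Htk.
- by rewrite Ebg; apply: rm_source => j' H; apply: ubg H Htk.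
Qed.

Theorem theorem1p2 (R : realType) (N : nat) (M M' : tri_data N) :
  gasket M -> gamma_isolated M ->
  (exists i j : 'I_N, Pag M i j || Pbg M i j) ->
  one_step_simplification M M' ->
  forall xi : R, 0 < xi < 1 -> lipschitz_equiv M M' xi.
Proof.
move=> gM [a [b [c [la lb_ lc _ [[i1 i2] [i3 i4] [i5 i6]]]]]] _ simp xi xi01.
have [lb lbE] : exists lb : 'I_3 -> 'I_N, forall v, lab M v = inl (lb v).
  exists (fun v => if v == vA then a else if v == vB then b else c) => v.
  by case: (ord3 v) => ->.
have ec : c = lb vC by have := lbE vC; rewrite lc => -[].
have iso u v j : ~~ P M u v (lb vC) j.
  by rewrite -ec; case: (ord3 u) (ord3 v) => -> [] ->;
    [|exact: i6|exact: i2|exact: i5| |exact: i4|exact: i1|exact: i3|].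
have [[inj [irr disj]] _] := gM; have lbI := lb_inj lbE gM.
have [tau [kappa [V [VC PV [dm1 dm2] PM']]]] := simplification_detaches gM simp.
have elab : lab M' = lab M by case: simp.
have M'_corners : corners M' = detach (lb vC) tau (corners M).
  apply/funext => i; apply/funext => p; apply/funext => j; apply/funext => q.
  apply/propext; split.
    move=> [u [v [uv /PM'[Pij n1 n2] lv lu]]]; rewrite elab !lbE in lv lu.
    case: lv lu => lv [lu]; split.
    - by exists u, v; rewrite !lbE lv lu.
    - by move=> [e ep]; apply: n1; split=> //; apply: lbI; rewrite lv.
    - by move=> [e eq]; apply: n2; split=> //; apply: lbI; rewrite lu.
  move=> [[u [v [uv Pij lv lu]]] n1 n2]; exists u, v; rewrite elab; split=> //.
  rewrite !lbE in lv lu; case: lv lu => lv [lu].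
  by apply/PM'; split=> // -[e ev]; [apply: n1|apply: n2]; rewrite e -?lv -?lu ev.
have E_rel := corners_rel lbE gM iso.
(* Double-maximality of [kappa]: a contact at its corner gamma would be a pair leaving [kappa] in
   [Pag] or [Pbg]. *)
have E_free j q : ~ corners M kappa (lb vC) j q.
  move=> [u [v [uv + lv _]]]; move: lv; rewrite lbE => -[/lbI e]; subst v.
  case: (ord3 u) uv => -> // _; apply/negP; [exact: dm1|exact: dm2].
(* [V] is alpha or beta, according to the set that contains [(tau, kappa)]; its letter is the [a] of
   the recoding. *)
have E_touch : corners M tau (lb vC) kappa (lb V) by exists V, vC; rewrite !lbE.
have [Phi [tot sur fwd bwd]] := recoding E_rel E_free E_touch.
have rM : realizes M (corners M) := realizes_corners lbE irr disj.
have rM' : realizes M' (detach (lb vC) tau (corners M)).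
  rewrite -M'_corners; apply: (realizes_corners (lb := lb)).
  - by move=> v; rewrite elab.
  - by move=> u v i; apply/negP => /PM'[H _ _]; move: H; apply/negP.
  - by move=> u v u' v' i j uv uv' /PM'[H1 _ _] /PM'[H2 _ _]; apply: disj H1 H2.
exact: (lipschitz_of_recoding xi01 E_rel (corner_rel_detach tau E_rel) rM rM' tot sur fwd bwd).
Qed.
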